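(* Let $S$ be a Rees semigroup with underlying group $G$, let $e=(i,p_{\lambda i}^{-1},\lambda)\in S$ with $p_{\lambda i}\neq\mathbf o$, and put $\mathcal A=\mathcal A(S)$, $\mathcal B=e\mathcal Ae$ (so $\mathcal B\cong\ell^1(G)$), $P=e\mathcal A$ and $Q=\mathcal Ae$. Then the modules $P$ and $Q$ give a Morita equivalence of $\mathcal A$ and $\mathcal B$; that is, multiplication gives bimodule isomorphisms $$\mathcal A\cong Q\widehat\otimes_{\mathcal B}P\qquad\text{and}\qquad \mathcal B\cong P\widehat\otimes_{\mathcal A}Q.$$
   Context: Rees semigroup: let $I,\Lambda$ be index sets, $G$ a (discrete) group, $\mathbf o$ an absorbing zero adjoined to $G$, and $(p_{\lambda i})_{\lambda\in\Lambda,i\in I}$ a sandwich matrix with entries in $G\cup\{\mathbf o\}$ such that every row and every column has at least one entry different from $\mathbf o$. The Rees semigroup is $S=(I\times G\times\Lambda)\cup\{\emptyset\}$, where $\emptyset$ is an absorbing zero and $(i,g,\lambda)(j,h,\mu)=(i,gp_{\lambda j}h,\mu)$ if $p_{\lambda j}\ne\mathbf o$, and $=\emptyset$ if $p_{\lambda j}=\mathbf o$. $G$ is the underlying group. $\ell^1(T)$ is the convolution Banach algebra of a semigroup $T$, and $\mathcal A(S)=\ell^1(S)/\mathbb C\emptyset$ is the reduced semigroup algebra; as a Banach space it is $\ell^1(I\times G\times\Lambda)$. Elements of $S\setminus\{\emptyset\}$ are identified with basis elements of $\mathcal A(S)$. The element $e$ is an idempotent and $\mathcal B=e\mathcal A(S)e=\ell^1(\{i\}\times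 G\times\{\lambda\})$ is isomorphic to $\ell^1(G)$ via $g\mapsto(i,gp_{\lambda i}^{-1},\lambda)$. $P$ is a $\mathcal B$-$\mathcal A$ bimodule and $Q$ an $\mathcal A$-$\mathcal B$ bimodule by multiplication. $\widehat\otimes$ is the projective tensor product, and $X\widehat\otimes_{\mathcal A}Y$ is the quotient of $X\widehat\otimes Y$ by the closed span of the elements $xa\otimes y-x\otimes ay$. A Banach $\mathcal A$-$\mathcal B$ bimodule $X$ is induced if multiplication $\mathcal A\widehat\otimes_{\mathcal A}X\widehat\otimes_{\mathcal B}\mathcal B\to X$, $a\otimes x\otimes b\mapsto axb$, is an isomorphism; $\mathcal A$ is self-induced if it is induced as an $\mathcal A$-bimodule. Two self-induced Banach algebras $\mathcal A,\mathcal B$ are Morita equivalent if there are induced modules $P$ (a Banach $\mathcal B$-$\mathcal A$ bimodule) and $Q$ (a Banach $\mathcal A$-$\mathcal B$ bimodule) with $P\widehat\otimes_{\mathcal A}Q\cong\mathcal B$ and $Q\widehat\otimes_{\mathcal B}P\cong\mathcal A$, the isomorphisms being implemented by bounded bilinear balanced module maps $[\cdot,\cdot]:P\times Q\to\mathcal B$ and $(\cdot,\cdot):Q\times P\to\mathcal A$ satisfying $[p,q].p'=p.(q,p')$ and $q.[p,q']=(q,p).q'$ for all $p,p'\in P$, $q,q'\in Q$. *)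

(* Defs.v *)
From HB Require Import structures.
From mathcomp Require Import all_boot all_order all_algebra finmap.
From mathcomp Require Import generic_quotient.
From mathcomp Require Import all_classical all_reals all_analysis.
From mathcomp Require Import complex ring lra.
From mathcomp.analysis.showcase Require summability.
Set Implicit Arguments.
Unset Strict Implicit.
Unset Printing Implicit Defensive.
Import Order.TTheory GRing.Theory Num.Theory.
Import numFieldNormedType.Exports.
Local Open Scope classical_set_scope.
Local Open Scope ring_scope.
Local Open Scope complex_scope.

Lemma pow_small {R : realType} (c e : R) : 0 < e -> exists n, c * 2^-1 ^+ n < e.
Proof.
move=> e0; have : (fun n => c * 2^-1 ^+ n : R^o) @ \oo --> (c * 0 : R^o).
  apply: cvgMr; apply: cvg_expr; rewrite ger0_norm ?invr_ge0//.
  by rewrite invf_lt1 ?ltr1n.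
rewrite mulr0 => /cvgrPdist_lt/(_ _ e0)[N _ /(_ N (leqnn N))] /=.
rewrite sub0r normrN => h; exists N; apply: le_lt_trans h; exact: ler_norm.
Qed.

Lemma pos_complexE {R : realType} (e : R[i]) : 0 < e ->
  e = (complex.Re e)%:C /\ 0 < complex.Re e.
Proof.
by case: e => a b; rewrite ltcE /= => /andP[/eqP -> a0].
Qed.

Section RealNorm.
Context {R : realType}.
Local Notation C := R[i].

(* Norms of complex normed modules take their values in R[i]; rnorm is the
   corresponding real number. *)
Definition rnorm (V : normedZmodType C) (x : V) : R := complex.Re `|x|.

Section Zmod.
Context {V : normedZmodType C}.
Implicit Types x y : V.

Lemma rnormE x : `|x| = (rnorm x)%:C.
Proof.
rewrite /rnorm; have := normr_ge0 x; case: `|x| => a b /=.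
by rewrite lecE /= => /andP[/eqP -> _].
Qed.

Lemma rnorm_ge0 x : 0 <= rnorm x.
Proof. by rewrite -lecR -rnormE normr_ge0. Qed.

Lemma rnormD x y : rnorm (x + y) <= rnorm x + rnorm y.
Proof. by rewrite -lecR rmorphD /= -!rnormE ler_normD. Qed.

Lemma rnormN x : rnorm (- x) = rnorm x.
Proof. by rewrite /rnorm normrN. Qed.

Lemma rnormB x y : rnorm (x - y) <= rnorm x + rnorm y.
Proof. by rewrite -(rnormN y) rnormD. Qed.

Lemma rnormC x y : rnorm (x - y) = rnorm (y - x).
Proof. by rewrite -rnormN opprB. Qed.

Lemma rnorm0 : rnorm (0 : V) = 0.
Proof. by rewrite /rnorm normr0. Qed.

Lemma rnorm0_eq0 x : rnorm x = 0 -> x = 0.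
Proof. by move=> x0; apply/eqP; rewrite -normr_eq0 rnormE x0. Qed.

Lemma rnorm_le0 x : rnorm x <= 0 -> x = 0.
Proof.
by move=> x0; apply/rnorm0_eq0/eqP; rewrite eq_le x0 rnorm_ge0.
Qed.

Lemma rnorm_tri z x y : rnorm (x - y) <= rnorm (x - z) + rnorm (z - y).
Proof. by rewrite (_ : x - y = (x - z) + (z - y)) ?rnormD// addrA subrK. Qed.

End Zmod.

Lemma rnorm_inj_le (V W : normedZmodType C) (x : V) (y : W) :
  (rnorm x <= rnorm y) = (`|x| <= `|y|).
Proof. by rewrite !rnormE lecR. Qed.

Lemma rnormM (a b : C) : rnorm (a * b) = rnorm a * rnorm b.
Proof.
have h : (rnorm (a * b))%:C = (rnorm a * rnorm b)%:C.
  by rewrite rmorphM /= -!rnormE normrM.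
by case: h.
Qed.

Lemma rnormR (a : R) : rnorm (a%:C) = `|a|.
Proof.
have h : (rnorm (a%:C))%:C = `|a|%:C by rewrite -rnormE normc_def /= expr0n addr0 sqrtr_sqr.
by case: h.
Qed.

Lemma rnorm1 : rnorm (1 : C) = 1.
Proof. by rewrite -[1]/(1%:C) rnormR normr1. Qed.

Lemma rnormZ (V : normedModType C) (a : C) (x : V) :
  rnorm (a *: x) = rnorm a * rnorm x.
Proof.
have h : (rnorm (a *: x))%:C = (rnorm a * rnorm x)%:C.
  by rewrite rmorphM /= -!rnormE normrZ.
by case: h.
Qed.

Lemma rnorm_sum (V : normedZmodType C) (I : Type) (s : seq I) (P : pred I)
    (F : I -> V) :
  rnorm (\sum_(i <- s | P i) F i) <= \sum_(i <- s | P i) rnorm (F i).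
Proof.
elim/big_rec2: _ => [|i y x _ h]; first by rewrite rnorm0.
by rewrite (le_trans (rnormD _ _))// lerD2l.
Qed.

Lemma complete_fast (V : normedModType C) (k : R) :
  (forall u : nat -> V, (forall n, rnorm (u n.+1 - u n) <= 2^-1 ^+ n) ->
    exists l, forall n, rnorm (l - u n) <= k * 2^-1 ^+ n) ->
  forall F : set_system V, ProperFilter F -> cauchy F -> cvg F.
Proof.
move=> H F FF /cauchyP Fc.
have pos n : (0 : C) < ((2^-1 ^+ n) / 4 : R)%:C.
  by rewrite ltcR divr_gt0// exprn_gt0// invr_gt0.
have /choice[u uP] : forall n, exists x : V, F (ball x ((2^-1 ^+ n) / 4 : R)%:C).
  by move=> n; exact: (Fc _ (pos n)).
have nearu n m : rnorm (u n - u m) <= (2^-1 ^+ n + 2^-1 ^+ m) / 4.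
  have [z [zn zm]] := filter_ex (filterI (uP n) (uP m)).
  move: zn zm; rewrite -!ball_normE /= !rnormE !ltcR => zn zm.
  rewrite (le_trans (rnorm_tri z _ _))// (rnormC z) mulrDl lerD// ltW//.
have hh n : (0 : R) < 2^-1 ^+ n by rewrite exprn_gt0// invr_gt0.
have [l lP] : exists l, forall n, rnorm (l - u n) <= k * 2^-1 ^+ n.
  apply: H => n; apply: (le_trans (nearu _ _)); rewrite exprS.
  by have := hh n; lra.
apply/cvg_ex; exists l; apply/cvgrPdist_le => /= e e0.
have [eE r0] := pos_complexE e0.
have [n /ltW nP] := pow_small (k + 1) r0.
apply: filterS (uP n) => x; rewrite -ball_normE /= !rnormE ltcR eE lecR => xn.
rewrite (le_trans (rnorm_tri (u n) _ _))//; apply: le_trans nP.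
rewrite mulrDl mul1r lerD// (le_trans (ltW xn))//.
by have := hh n; lra.
Qed.

End RealNorm.

Section BoundedMaps.
Context {R : realType}.
Local Notation C := R[i].

Definition bounded_linear (V W : normedModType C) (f : V -> W) : Prop :=
  linear f /\ exists M : R, forall x, rnorm (f x) <= M * rnorm x.

Definition bounded_bilinear (U V W : normedModType C) (b : U -> V -> W) : Prop :=
  [/\ forall y, linear (fun x => b x y), forall x, linear (b x) &
      exists M : R, forall x y, rnorm (b x y) <= M * (rnorm x * rnorm y)].

(* Isomorphisms of Banach spaces are not required to be isometric. *)
Definition banach_iso (V W : normedModType C) (f : V -> W) : Prop :=
  bounded_linear f /\
  exists g : W -> V, [/\ bounded_linear g, cancel f g & cancel g f].

Section Linear.
Context {V W : lmodType C} {f : V -> W}.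
Hypothesis lf : linear f.

Lemma linD x y : f (x + y) = f x + f y.
Proof. by have := lf 1 x y; rewrite !scale1r. Qed.
Lemma lin0 : f 0 = 0.
Proof. by apply: (@addrI _ (f 0)); rewrite -linD !addr0. Qed.
Lemma linZ a x : f (a *: x) = a *: f x.
Proof. by have := lf a x 0; rewrite lin0 !addr0. Qed.
Lemma linN x : f (- x) = - f x.
Proof. by rewrite -scaleN1r linZ scaleN1r. Qed.
Lemma linB x y : f (x - y) = f x - f y.
Proof. by rewrite linD linN. Qed.
Lemma lin_sum (I : Type) (s : seq I) (F : I -> V) :
  f (\sum_(i <- s) F i) = \sum_(i <- s) f (F i).
Proof. by elim/big_rec2: _ => [|i y x _ <-]; rewrite ?lin0 ?linD. Qed.
End Linear.

Lemma bl_bound (V W : normedModType C) (f : V -> W) : bounded_linear f ->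
  exists2 M : R, 0 <= M & forall x, rnorm (f x) <= M * rnorm x.
Proof.
move=> [_ [M MP]]; exists `|M| => // x; apply: (le_trans (MP x)).
by rewrite ler_wpM2r ?rnorm_ge0// ler_norm.
Qed.

Lemma bb_bound (U V W : normedModType C) (b : U -> V -> W) : bounded_bilinear b ->
  exists2 M : R, 0 <= M & forall x y, rnorm (b x y) <= M * (rnorm x * rnorm y).
Proof.
move=> [_ _ [M MP]]; exists `|M| => // x y; apply: (le_trans (MP x y)).
by rewrite ler_wpM2r ?mulr_ge0 ?rnorm_ge0// ler_norm.
Qed.

Lemma bl_id (V : normedModType C) : bounded_linear (fun x : V => x).
Proof. by split=> [a x y //|]; exists 1 => x; rewrite mul1r. Qed.

Lemma bl_comp (U V W : normedModType C) (f : V -> W) (g : U -> V) :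
  bounded_linear f -> bounded_linear g -> bounded_linear (fun x => f (g x)).
Proof.
move=> fb gb; have [M M0 MP] := bl_bound fb; have [N N0 NP] := bl_bound gb.
have [[lf _] [lg _]] := (fb, gb); split=> [a x y|]; first by rewrite lg lf.
exists (M * N) => x; apply: (le_trans (MP _)).
by rewrite -mulrA ler_wpM2l.
Qed.

Lemma bl_lincomb (V W : normedModType C) (a : C) (f g : V -> W) :
  bounded_linear f -> bounded_linear g -> bounded_linear (fun x => a *: f x + g x).
Proof.
move=> fb gb; have [M M0 MP] := bl_bound fb; have [N N0 NP] := bl_bound gb.
have [[lf _] [lg _]] := (fb, gb); split=> [c x y|].
  rewrite lf lg !scalerDr !scalerA (mulrC a c); rewrite -!addrA; congr (_ + _).
  by rewrite addrCA.
exists (rnorm a * M + N) => x; apply: (le_trans (rnormD _ _)).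
by rewrite rnormZ mulrDl lerD// -mulrA ler_wpM2l// rnorm_ge0.
Qed.

Lemma bb_left (U V W : normedModType C) (b : U -> V -> W) y :
  bounded_bilinear b -> bounded_linear (fun x => b x y).
Proof.
move=> bb; have [M M0 MP] := bb_bound bb; have [l _ _] := bb; split=> //.
by exists (M * rnorm y) => x; rewrite -mulrA (mulrC (rnorm y)).
Qed.

Lemma bb_right (U V W : normedModType C) (b : U -> V -> W) x :
  bounded_bilinear b -> bounded_linear (b x).
Proof.
move=> bb; have [M M0 MP] := bb_bound bb; have [_ l _] := bb; split=> //.
by exists (M * rnorm x) => y; rewrite -mulrA.
Qed.

Lemma bb_comp (U V W Z : normedModType C) (f : W -> Z) (b : U -> V -> W) :
  bounded_linear f -> bounded_bilinear b ->
  bounded_bilinear (fun x y => f (b x y)).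
Proof.
move=> fb bb; have [M M0 MP] := bl_bound fb; have [N N0 NP] := bb_bound bb.
have [[lf _] [l1 l2 _]] := (fb, bb); split.
- by move=> y a x x'; rewrite l1 lf.
- by move=> x a y y'; rewrite l2 lf.
by exists (M * N) => x y; rewrite (le_trans (MP _))// -mulrA ler_wpM2l.
Qed.

Lemma bb_compl (U U' V W : normedModType C) (f : U -> U') (b : U' -> V -> W) :
  bounded_linear f -> bounded_bilinear b ->
  bounded_bilinear (fun x y => b (f x) y).
Proof.
move=> fb bb; have [M M0 MP] := bl_bound fb; have [N N0 NP] := bb_bound bb.
have [[lf _] [l1 l2 _]] := (fb, bb); split.
- by move=> y a x x'; rewrite lf l1.
- by move=> x a y y'; rewrite l2.
exists (N * M) => x y; rewrite (le_trans (NP _ _))// -mulrA ler_wpM2l//.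
by rewrite mulrA ler_wpM2r// rnorm_ge0.
Qed.

Lemma bb_flip (U V W : normedModType C) (b : U -> V -> W) :
  bounded_bilinear b -> bounded_bilinear (fun y x => b x y).
Proof.
move=> [l1 l2 [M MP]]; split=> //; exists M => y x.
by rewrite (mulrC (rnorm y)).
Qed.

Lemma bb_compr (U V V' W : normedModType C) (f : V -> V') (b : U -> V' -> W) :
  bounded_linear f -> bounded_bilinear b ->
  bounded_bilinear (fun x y => b x (f y)).
Proof. by move=> fb bb; exact: bb_flip (bb_compl fb (bb_flip bb)). Qed.

End BoundedMaps.

Section ClosedSubspaces.
Context {R : realType}.
Local Notation C := R[i].

Record csubspace (V : normedModType C) := CSubspace {
  csub_set :> V -> Prop;
  csub0 : csub_set 0;
  csubP : forall (a : C) x y, csub_set x -> csub_set y -> csub_set (a *: x + y);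
  csub_closed : closed (csub_set : set V) }.

Section Theory.
Context {V : normedModType C}.

Lemma closed_approx (U : set V) : closed U <->
  (forall l, (forall e : R, 0 < e -> exists2 y, U y & rnorm (l - y) <= e) -> U l).
Proof.
split=> [cU l lP|H].
  apply: cU => A; rewrite -nbhs_ballE => -[e /= e0 eA].
  have [eE r0] := pos_complexE e0.
  have [y Uy ly] := lP (complex.Re e / 2) ltac:(by rewrite divr_gt0).
  exists y; split=> //; apply: eA; rewrite -ball_normE /= rnormE eE ltcR.
  by apply: (le_lt_trans ly); lra.
move=> l cl; apply: H => e e0.
have e0' : 0 < (e%:C : C) by rewrite ltcR.
have [y [Uy]] := cl _ (nbhsx_ballx l _ e0').
rewrite -ball_normE /= rnormE ltcR => /ltW ly; by exists y.
Qed.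

Variable U : csubspace V.
Lemma csubD x y : U x -> U y -> U (x + y).
Proof. by move=> Ux Uy; rewrite -(scale1r x); exact: csubP. Qed.
Lemma csubZ a x : U x -> U (a *: x).
Proof. by move=> Ux; rewrite -(addr0 (a *: x)); apply: csubP => //; exact: csub0. Qed.
Lemma csubN x : U x -> U (- x).
Proof. by rewrite -scaleN1r; exact: csubZ. Qed.
Lemma csubB x y : U x -> U y -> U (x - y).
Proof. by move=> Ux /csubN; exact: csubD. Qed.
End Theory.

Section Span.
Context {V : normedModType C} (S : set V).
Definition cspan_set : set V :=
  [set x | forall U : csubspace V, S `<=` U -> U x].

Fact cspan0 : cspan_set 0. Proof. by move=> U _; exact: csub0. Qed.
Fact cspanP (a : C) x y : cspan_set x -> cspan_set y -> cspan_set (a *: x + y).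
Proof. by move=> hx hy U SU; apply: csubP; [exact: hx|exact: hy]. Qed.
Fact cspan_closed : closed cspan_set.
Proof.
apply/closed_approx => l lP U SU.
have /closed_approx := @csub_closed _ U; apply=> e /lP[y /(_ U SU) Uy ly].
by exists y.
Qed.
Definition cspan : csubspace V := CSubspace cspan0 cspanP cspan_closed.

Lemma sub_cspan : S `<=` cspan.
Proof. by move=> x Sx U; exact. Qed.
End Span.

Lemma bl_ker_csub (V W : normedModType C) (f : V -> W) : bounded_linear f ->
  {U : csubspace V | forall x, U x <-> f x = 0}.
Proof.
move=> fb; have [lf _] := fb.
have h0 : [set x | f x = 0] 0 by exact: (lin0 lf).
have hP (a : C) x y : [set x | f x = 0] x -> [set x | f x = 0] y ->
    [set x | f x = 0] (a *: x + y).
  by rewrite /= lf => -> ->; rewrite scaler0 addr0.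
have hc : closed [set x | f x = 0].
  apply/closed_approx => l lP; apply: rnorm_le0; apply/ler_addgt0Pr => e e0.
  have [M M0 MP] := bl_bound fb; rewrite add0r.
  have [y /= fy ly] := lP (e / (M + 1)) ltac:(by rewrite divr_gt0// ltr_wpDl).
  rewrite -(subr0 (f l)) -fy -linB// (le_trans (MP _))//.
  rewrite (le_trans (ler_wpM2l M0 ly))// mulrA ler_pdivrMr ?ltr_wpDl// mulrC.
  by rewrite ler_pM2l// lerDl.
by exists (CSubspace h0 hP hc).
Qed.

Lemma cspan_ker (V W : normedModType C) (S : set V) (f : V -> W) :
  bounded_linear f -> (forall x, S x -> f x = 0) ->
  forall x, cspan S x -> f x = 0.
Proof.
move=> /bl_ker_csub[U UP] h x; move/(_ U) => xS; apply/UP; apply: xS => y Sy.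
by apply/UP/h.
Qed.

End ClosedSubspaces.

Section SubBanach.
Context {R : realType}.
Local Notation C := R[i].
Context {V : completeNormedModType C} (U : csubspace V).

Record subban := SubBan { sbval : V; sbvalP : U sbval }.

Lemma sbval_inj : injective sbval.
Proof.
by move=> [x px] [y py] /= e; subst y; congr SubBan; exact: Prop_irrelevance.
Qed.

HB.instance Definition _ := gen_eqMixin subban.
HB.instance Definition _ := gen_choiceMixin subban.

Definition sb_zero := SubBan (csub0 U).
Definition sb_add (x y : subban) := SubBan (csubD (sbvalP x) (sbvalP y)).
Definition sb_opp (x : subban) := SubBan (csubN (sbvalP x)).
Definition sb_scale (a : C) (x : subban) := SubBan (csubZ a (sbvalP x)).

Fact sb_addA : associative sb_add.
Proof. by move=> x y z; apply: sbval_inj; exact: addrA. Qed.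
Fact sb_addC : commutative sb_add.
Proof. by move=> x y; apply: sbval_inj; exact: addrC. Qed.
Fact sb_add0 : left_id sb_zero sb_add.
Proof. by move=> x; apply: sbval_inj; exact: add0r. Qed.
Fact sb_addN : left_inverse sb_zero sb_opp sb_add.
Proof. by move=> x; apply: sbval_inj; exact: addNr. Qed.
HB.instance Definition _ :=
  GRing.isZmodule.Build subban sb_addA sb_addC sb_add0 sb_addN.

Fact sb_scaleA a b x : sb_scale a (sb_scale b x) = sb_scale (a * b) x.
Proof. by apply: sbval_inj; exact: scalerA. Qed.
Fact sb_scale1 : left_id 1 sb_scale.
Proof. by move=> x; apply: sbval_inj; exact: scale1r. Qed.
Fact sb_scaleDr : right_distributive sb_scale +%R.
Proof. by move=> a x y; apply: sbval_inj; exact: scalerDr. Qed.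
Fact sb_scaleDl x : {morph sb_scale^~ x : a b / a + b}.
Proof. by move=> a b; apply: sbval_inj; exact: scalerDl. Qed.
HB.instance Definition _ := GRing.Zmodule_isLmodule.Build C subban
  sb_scaleA sb_scale1 sb_scaleDr sb_scaleDl.

Definition sb_norm (x : subban) : C := `|sbval x|.
Fact sb_normD x y : sb_norm (x + y) <= sb_norm x + sb_norm y.
Proof. exact: ler_normD. Qed.
Fact sb_normZ (a : C) x : sb_norm (a *: x) = `|a| * sb_norm x.
Proof. exact: normrZ. Qed.
Fact sb_norm0 x : sb_norm x = 0 -> x = 0.
Proof. by move/normr0_eq0 => h; apply: sbval_inj. Qed.
HB.instance Definition _ :=
  Lmodule_isNormed.Build C subban sb_normD sb_normZ sb_norm0.

Lemma rnorm_sbval (x : subban) : rnorm (sbval x) = rnorm x.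
Proof. by []. Qed.

Lemma sbvalB (x y : subban) : sbval (x - y) = sbval x - sbval y.
Proof. by []. Qed.

Lemma fast_cvg (W : completeNormedModType C) (u : nat -> W) :
  (forall n, rnorm (u n.+1 - u n) <= 2^-1 ^+ n) ->
  exists l, forall n, rnorm (l - u n) <= 2 * 2^-1 ^+ n.
Proof.
move=> uP.
have step n k : rnorm (u (n + k)%N - u n) <= (2 * 2^-1 ^+ n) * (1 - 2^-1 ^+ k).
  elim: k => [|k IH]; first by rewrite addn0 !subrr rnorm0 mulr0.
  rewrite addnS; apply: (le_trans (rnorm_tri (u (n + k)%N) _ _)).
  have h := uP (n + k)%N; apply: (le_trans (lerD h IH)).
  rewrite exprD exprS !mulrBr; set a := 2^-1 ^+ n; set b := 2^-1 ^+ k; lra.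
have hh n : (0 : R) < 2^-1 ^+ n by rewrite exprn_gt0// invr_gt0.
have step' n k : rnorm (u (n + k)%N - u n) <= 2 * 2^-1 ^+ n.
  by apply: (le_trans (step n k)); have := hh n; have := hh k; nra.
have : cauchy (u @ \oo).
  apply: cauchy_exP => e e0; have [eE r0] := pos_complexE e0.
  have [N NP] := pow_small 2 r0; exists (u N), N => // m /= Nm.
  rewrite -ball_normE /= rnormE eE ltcR rnormC -(subnKC Nm).
  exact: le_lt_trans NP.
move/cauchy_cvgP => /cvg_ex[l ul]; exists l => n.
apply/ler_addgt0Pr => e e0.
have e0' : 0 < (e%:C : C) by rewrite ltcR.
have /cvgrPdist_le/(_ _ e0')[N _ NP] := ul.
have := NP (n + N)%N (leq_addl _ _); rewrite /= rnormE lecR => h.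
apply: (le_trans (rnorm_tri (u (n + N)%N) _ _)).
by rewrite addrC lerD.
Qed.

Fact sb_complete (F : set_system subban) : ProperFilter F -> cauchy F -> cvg F.
Proof.
apply: (@complete_fast _ _ 2) => u uP.
have [l lP] := @fast_cvg V (fun n => sbval (u n)) uP.
have Ul : U l.
  have /closed_approx := @csub_closed _ _ U; apply=> e e0.
  have [n /ltW nP] := pow_small 2 e0.
  by exists (sbval (u n)); [exact: sbvalP|rewrite (le_trans (lP n))].
by exists (SubBan Ul).
Qed.
HB.instance Definition _ := Uniform_isComplete.Build subban sb_complete.

End SubBanach.

Section QuotBanach.
Context {R : realType}.
Local Notation C := R[i].
Context {V : completeNormedModType C} (U : csubspace V).
Local Open Scope quotient_scope.

Definition qb_equiv (x y : V) : bool := `[< U (x - y) >].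

Fact qb_equiv_class : equiv_class_of qb_equiv.
Proof.
split=> [x|x y|y x z].
- by apply/asboolP; rewrite subrr; exact: csub0.
- by apply/asboolP/asboolP => /csubN; rewrite opprB.
- move=> /asboolP xy /asboolP yz; apply/asboolP.
  by rewrite -(subrK y x) -addrA; exact: csubD.
Qed.
Canonical qb_equivR := EquivRelPack qb_equiv_class.
Canonical qb_equivE := defaultEncModRel qb_equiv.

Definition quotban := {eq_quot qb_equiv}.
HB.instance Definition _ : EqQuotient _ qb_equiv quotban := EqQuotient.on quotban.
HB.instance Definition _ := Choice.on quotban.

Definition qpi (x : V) : quotban := \pi_quotban x.

Lemma qpi_eq x y : qpi x = qpi y <-> U (x - y).
Proof.
split=> [/eqP|h]; rewrite /qpi.
  by rewrite piE => /asboolP.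
by apply/eqP; rewrite piE; apply/asboolP.
Qed.

Lemma qpi_surj q : exists x, qpi x = q.
Proof. by exists (repr q); rewrite /qpi reprK. Qed.

Lemma qpi_repr x : U (repr (qpi x) - x).
Proof. by apply/qpi_eq; rewrite /qpi reprK. Qed.

Definition qb_zero := qpi 0.
Definition qb_add (p q : quotban) := qpi (repr p + repr q).
Definition qb_opp (p : quotban) := qpi (- repr p).
Definition qb_scale (a : C) (p : quotban) := qpi (a *: repr p).

Fact qb_addE x y : qb_add (qpi x) (qpi y) = qpi (x + y).
Proof.
apply/qpi_eq; rewrite opprD addrACA; apply: csubD; exact: qpi_repr.
Qed.
Fact qb_oppE x : qb_opp (qpi x) = qpi (- x).
Proof. by apply/qpi_eq; rewrite -opprD; apply: csubN; exact: qpi_repr. Qed.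
Fact qb_scaleE a x : qb_scale a (qpi x) = qpi (a *: x).
Proof. by apply/qpi_eq; rewrite -scalerBr; apply: csubZ; exact: qpi_repr. Qed.

Fact qb_addA : associative qb_add.
Proof.
move=> p q r; have [[[x <-] [y <-]] [z <-]] := (qpi_surj p, qpi_surj q, qpi_surj r).
by rewrite !qb_addE addrA.
Qed.
Fact qb_addC : commutative qb_add.
Proof.
move=> p q; have [[x <-] [y <-]] := (qpi_surj p, qpi_surj q).
by rewrite !qb_addE addrC.
Qed.
Fact qb_add0 : left_id qb_zero qb_add.
Proof. by move=> p; have [x <-] := qpi_surj p; rewrite qb_addE add0r. Qed.
Fact qb_addN : left_inverse qb_zero qb_opp qb_add.
Proof. by move=> p; have [x <-] := qpi_surj p; rewrite qb_oppE qb_addE addNr. Qed.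
HB.instance Definition _ :=
  GRing.isZmodule.Build quotban qb_addA qb_addC qb_add0 qb_addN.

Fact qb_scaleA a b p : qb_scale a (qb_scale b p) = qb_scale (a * b) p.
Proof. by have [x <-] := qpi_surj p; rewrite !qb_scaleE scalerA. Qed.
Fact qb_scale1 : left_id 1 qb_scale.
Proof. by move=> p; have [x <-] := qpi_surj p; rewrite qb_scaleE scale1r. Qed.
Fact qb_scaleDr : right_distributive qb_scale +%R.
Proof.
move=> a p q; have [[x <-] [y <-]] := (qpi_surj p, qpi_surj q).
by rewrite [_ + _]qb_addE !qb_scaleE [RHS]qb_addE scalerDr.
Qed.
Fact qb_scaleDl p : {morph qb_scale^~ p : a b / a + b}.
Proof.
move=> a b; have [x <-] := qpi_surj p.
by rewrite !qb_scaleE [RHS]qb_addE scalerDl.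
Qed.
HB.instance Definition _ := GRing.Zmodule_isLmodule.Build C quotban
  qb_scaleA qb_scale1 qb_scaleDr qb_scaleDl.

Lemma qpiD x y : qpi (x + y) = qpi x + qpi y.
Proof. by rewrite [RHS]qb_addE. Qed.
Lemma qpiZ a x : qpi (a *: x) = a *: qpi x.
Proof. by rewrite [RHS]qb_scaleE. Qed.
Lemma qpi_linear : linear qpi.
Proof. by move=> a x y; rewrite qpiD qpiZ. Qed.
Lemma qpi_eq0 x : qpi x = 0 <-> U x.
Proof. by rewrite -[0]/(qpi 0) qpi_eq subr0. Qed.

Definition qb_rnorm (q : quotban) : R := inf [set rnorm x | x in [set x | qpi x = q]].

Fact qb_has_inf q : has_inf [set rnorm x | x in [set x | qpi x = q]].
Proof.
split; first by have [x xq] := qpi_surj q; exists (rnorm x), x.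
by exists 0 => _ [x _ <-]; exact: rnorm_ge0.
Qed.
Lemma qb_rnorm_ge0 q : 0 <= qb_rnorm q.
Proof.
apply: lb_le_inf; first by have [] := qb_has_inf q.
by move=> _ [x _ <-]; exact: rnorm_ge0.
Qed.
Lemma qb_rnorm_le x : qb_rnorm (qpi x) <= rnorm x.
Proof. by apply: ge_inf; [have [] := qb_has_inf (qpi x)|exists x]. Qed.
Lemma qb_rnorm_lt q (e : R) : 0 < e ->
  exists2 x, qpi x = q & rnorm x < qb_rnorm q + e.
Proof.
move=> e0; have [_ [x xq <-] h] := inf_adherent e0 (qb_has_inf q).
by exists x.
Qed.

Definition qb_norm (q : quotban) : C := (qb_rnorm q)%:C.

Fact qb_normD p q : qb_norm (p + q) <= qb_norm p + qb_norm q.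
Proof.
rewrite /qb_norm -rmorphD lecR /=; apply/ler_addgt0Pr => e e0.
have e2 : 0 < e / 2 by rewrite divr_gt0.
have [x <- xl] := qb_rnorm_lt p e2; have [y <- yl] := qb_rnorm_lt q e2.
rewrite -qpiD (le_trans (qb_rnorm_le _))// (le_trans (rnormD _ _))//; lra.
Qed.
Fact qb_rnormZ (a : C) q : qb_rnorm (a *: q) <= rnorm a * qb_rnorm q.
Proof.
apply/ler_addgt0Pr => e e0.
have a1 : 0 < rnorm a + 1 by rewrite ltr_wpDl// rnorm_ge0.
have e2 : 0 < e / (rnorm a + 1) by rewrite divr_gt0.
have [x <- xl] := qb_rnorm_lt q e2.
rewrite -qpiZ (le_trans (qb_rnorm_le _))// rnormZ.
rewrite (le_trans (ler_wpM2l (rnorm_ge0 _) (ltW xl)))// mulrDr lerD2l.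
by rewrite mulrA ler_pdivrMr// mulrC ler_pM2l// lerDl.
Qed.
Fact qb_normZ (a : C) q : qb_norm (a *: q) = `|a| * qb_norm q.
Proof.
rewrite /qb_norm rnormE -rmorphM /=; congr (_%:C); apply/eqP.
rewrite eq_le qb_rnormZ /=; have [->|a0] := eqVneq a 0.
  by rewrite rnorm0 mul0r qb_rnorm_ge0.
rewrite -[in leLHS](scale1r q) -(mulVf a0) -scalerA.
rewrite (le_trans (ler_wpM2l (rnorm_ge0 _) (qb_rnormZ _ _)))//.
by rewrite mulrA -rnormM mulfV// rnorm1 mul1r.
Qed.
Fact qb_norm0 q : qb_norm q = 0 -> q = 0.
Proof.
move=> [q0]; have [x xq] := qpi_surj q; rewrite -xq; apply/qpi_eq0.
have /closed_approx := @csub_closed _ _ U; apply=> e e0.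
have [y yq yl] := qb_rnorm_lt q e0.
exists (x - y); first by apply/qpi_eq; rewrite xq yq.
by rewrite opprB addrC subrK ltW// (lt_le_trans yl)// q0 add0r.
Qed.
HB.instance Definition _ :=
  Lmodule_isNormed.Build C quotban qb_normD qb_normZ qb_norm0.

Lemma rnorm_qb q : rnorm q = qb_rnorm q. Proof. by []. Qed.

Lemma rnorm_qpi x : rnorm (qpi x) <= rnorm x.
Proof. exact: qb_rnorm_le. Qed.

Lemma qpi_lift q (e : R) : 0 < e -> exists2 x, qpi x = q & rnorm x < rnorm q + e.
Proof. exact: qb_rnorm_lt. Qed.

Lemma qpi_bl : bounded_linear qpi.
Proof.
by split; [exact: qpi_linear|exists 1 => x; rewrite mul1r rnorm_qpi].
Qed.

Fact qb_complete (F : set_system quotban) : ProperFilter F -> cauchy F -> cvg F.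
Proof.
apply: (@complete_fast _ _ 4) => u uP.
have pos n : (0 : R) < 2^-1 ^+ n by rewrite exprn_gt0// invr_gt0.
have [x0 x0P] := qpi_surj (u 0).
have /choice[d dP] : forall n, exists d : V,
    qpi d = u n.+1 - u n /\ rnorm d <= 2 * 2^-1 ^+ n.
  move=> n; have [d d1 d2] := qpi_lift (u n.+1 - u n) (pos n).
  by exists d; split=> //; rewrite (le_trans (ltW d2))//; have := uP n; lra.
pose v n := 2^-1 *: (x0 + \sum_(k < n) d k).
have vP n : rnorm (v n.+1 - v n) <= 2^-1 ^+ n.
  rewrite /v -scalerBr big_ord_recr /= addrA [in X in X - _]addrC addrK rnormZ.
  have -> : rnorm (2^-1 : C) = 2^-1.
    by rewrite -[2^-1]/(2%:R^-1) -(rmorph_nat (real_complex R)) -fmorphV rnormR ger0_norm// invr_ge0.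
  by have [_] := dP n; lra.
have [l lP] := fast_cvg vP.
exists (qpi (2 *: l)) => n.
have -> : u n = qpi (2 *: v n).
  rewrite /v scalerA mulfV ?pnatr_eq0// scale1r; elim: n => [|n IH].
    by rewrite big_ord0 addr0.
  by rewrite big_ord_recr /= addrA qpiD -IH (proj1 (dP n)) addrC subrK.
rewrite -[- qpi _]scaleN1r -qpiZ -qpiD scaleN1r -scalerBr.
rewrite (le_trans (rnorm_qpi _))// rnormZ.
have -> : rnorm (2 : C) = 2.
  by rewrite -(rmorph_nat (real_complex R)) rnormR ger0_norm.
by have := lP n; lra.
Qed.
HB.instance Definition _ := Uniform_isComplete.Build quotban qb_complete.

End QuotBanach.

Section QuotLift.
Context {R : realType}.
Local Notation C := R[i].
Context {V : completeNormedModType C} {U : csubspace V}.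
Context {W : normedModType C}.

Lemma quotban_lift (f : V -> W) (M : R) : linear f ->
  (forall x, rnorm (f x) <= M * rnorm x) -> (forall x, U x -> f x = 0) ->
  exists g : quotban U -> W,
    [/\ linear g, forall q, rnorm (g q) <= M * rnorm q
      & forall x, g (qpi U x) = f x].
Proof.
move=> lf fM f0; pose g (q : quotban U) := f (repr q).
have gE x : g (qpi U x) = f x.
  by apply/eqP; rewrite -subr_eq0 -(linB lf); apply/eqP/f0; exact: qpi_repr.
exists g; split=> //.
  move=> a p q; have [[x <-] [y <-]] := (qpi_surj p, qpi_surj q).
  by rewrite -qpiZ -qpiD !gE lf.
move=> q; have [M0|M0] := ltP M 0.
  have [x <-] := qpi_surj q; have := fM x; rewrite gE.
  move=> h; suff -> : qpi U x = 0.
    have x0 : x = 0.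
      apply/rnorm_le0; have := rnorm_ge0 (f x); have := rnorm_ge0 x; nra.
    by rewrite x0 (lin0 lf) !rnorm0 mulr0.
  have x0 : x = 0.
    apply/rnorm_le0; have := rnorm_ge0 (f x); have := rnorm_ge0 x; nra.
  by rewrite x0.
apply/ler_addgt0Pr => e e0.
have e2 : 0 < e / (M + 1) by rewrite divr_gt0// ltr_wpDl.
have [x xq xl] := qpi_lift q e2; rewrite -xq gE (le_trans (fM x))// xq.
rewrite (le_trans (ler_wpM2l M0 (ltW xl)))// mulrDr lerD2l.
by rewrite mulrA ler_pdivrMr ?ltr_wpDl// mulrC ler_pM2l// lerDl.
Qed.

Lemma quotban_bl (f : V -> W) : bounded_linear f -> (forall x, U x -> f x = 0) ->
  exists2 g : quotban U -> W, bounded_linear g & forall x, g (qpi U x) = f x.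
Proof.
move=> [lf [M fM]] f0; have [g [g1 g2 g3]] := quotban_lift lf fM f0.
by exists g => //; split=> //; exists M.
Qed.

End QuotLift.

Section ComplexComplete.
Context {R : realType}.
Local Notation C := R[i].

Lemma fast_cvgR (u : nat -> R) : (forall n, `|u n.+1 - u n| <= 2^-1 ^+ n) ->
  exists l, forall n, `|l - u n| <= 2 * 2^-1 ^+ n.
Proof.
move=> uP.
have step n k : `|u (n + k)%N - u n| <= (2 * 2^-1 ^+ n) * (1 - 2^-1 ^+ k).
  elim: k => [|k IH]; first by rewrite addn0 !subrr normr0 mulr0.
  rewrite addnS; apply: (le_trans (ler_distD (u (n + k)%N) _ _)).
  have h := uP (n + k)%N; apply: (le_trans (lerD h IH)).
  rewrite exprD exprS !mulrBr; set a := 2^-1 ^+ n; set b := 2^-1 ^+ k; lra.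
have hh n : (0 : R) < 2^-1 ^+ n by rewrite exprn_gt0// invr_gt0.
have step' n k : `|u (n + k)%N - u n| <= 2 * 2^-1 ^+ n.
  by apply: (le_trans (step n k)); have := hh n; have := hh k; nra.
have : cauchy ((u : nat -> R^o) @ \oo).
  apply: cauchy_exP => e e0.
  have [N NP] := pow_small 2 e0; exists (u N), N => // m /= Nm.
  rewrite -ball_normE /= distrC -(subnKC Nm).
  exact: le_lt_trans NP.
move/cauchy_cvgP => /cvg_ex[l ul]; exists l => n.
apply/ler_addgt0Pr => e e0.
have /cvgrPdist_le/(_ _ e0)[N _ NP] := ul.
have := NP (n + N)%N (leq_addl _ _) => /= h.
by apply: (le_trans (ler_distD (u (n + N)%N) _ _)); rewrite addrC lerD.
Qed.

Lemma rnorm_Re_le (z : C) : `|complex.Re z| <= rnorm z.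
Proof.
case: z => a b; rewrite /rnorm normc_def /=.
by rewrite -sqrtr_sqr ler_wsqrtr// lerDl sqr_ge0.
Qed.

Lemma rnorm_Im_le (z : C) : `|complex.Im z| <= rnorm z.
Proof.
case: z => a b; rewrite /rnorm normc_def /=.
by rewrite -[in leLHS]sqrtr_sqr ler_wsqrtr// lerDr sqr_ge0.
Qed.

Lemma rnorm_le_ReIm (z : C) : rnorm z <= `|complex.Re z| + `|complex.Im z|.
Proof.
case: z => a b; rewrite /rnorm normc_def /= -[leRHS]ger0_norm ?addr_ge0//.
rewrite -sqrtr_sqr ler_wsqrtr// sqrrD !real_normK ?num_real//.
have : 0 <= `|a| * `|b| by rewrite mulr_ge0.
by rewrite mulr2n; lra.
Qed.

Lemma fast_cvgC (u : nat -> C) : (forall n, rnorm (u n.+1 - u n) <= 2^-1 ^+ n) ->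
  exists l, forall n, rnorm (l - u n) <= 4 * 2^-1 ^+ n.
Proof.
move=> uP.
have [|a aP] := @fast_cvgR (fun n => complex.Re (u n)).
  move=> n; apply: le_trans (uP n); apply: le_trans (rnorm_Re_le _).
  by rewrite raddfB.
have [|b bP] := @fast_cvgR (fun n => complex.Im (u n)).
  move=> n; apply: le_trans (uP n); apply: le_trans (rnorm_Im_le _).
  by rewrite raddfB.
exists (a +i* b) => n; apply: (le_trans (rnorm_le_ReIm _)).
have := aP n; have := bP n; case: (u n) => x y /=; lra.
Qed.

End ComplexComplete.

Section EllOne.
Context {R : realType}.
Local Notation C := R[i].
Context {T : choiceType}.

Lemma sum_fset_le_esum (f : T -> C) (A : {fset T}) :
  ((\sum_(t <- A) rnorm (f t))%:E <= \esum_(t in [set: T]) (rnorm (f t))%:E)%E.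
Proof.
apply: esum_ge; exists [set` A].
  by split; [exact: finite_fset|].
by rewrite fsbig_finite ?finite_fset// set_fsetK sumEFin.
Qed.

Lemma esum_le_fset (f : T -> C) (M : R) :
  (forall A : {fset T}, \sum_(t <- A) rnorm (f t) <= M) ->
  (\esum_(t in [set: T]) (rnorm (f t))%:E <= M%:E)%E.
Proof.
move=> h; apply: ge_ereal_sup => _ [A [fA _] <-].
by rewrite fsbig_finite// sumEFin lee_fin.
Qed.

Lemma summableP (f : T -> C) : summable [set: T] (fun t => (rnorm (f t))%:E) <->
  exists M : R, forall A : {fset T}, \sum_(t <- A) rnorm (f t) <= M.
Proof.
have e : (\esum_(t in [set: T]) `|(rnorm (f t))%:E| =
          \esum_(t in [set: T]) (rnorm (f t))%:E)%E.
  by apply: eq_esum => t _; rewrite gee0_abs// lee_fin rnorm_ge0.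
rewrite /summable e; split=> [fin|[M MP]].
  exists (fine (\esum_(t in [set: T]) (rnorm (f t))%:E)) => A.
  rewrite -lee_fin fineK ?sum_fset_le_esum// ge0_fin_numE//.
  by apply: esum_ge0 => t _; rewrite lee_fin rnorm_ge0.
by rewrite (le_lt_trans (esum_le_fset MP))// ltry.
Qed.

End EllOne.

Section EllOneType.
Context (R : realType) (T : choiceType).
Local Notation C := R[i].

Record l1 := EllOne { l1fun :> T -> C;
  l1P : summable [set: T] (fun t => (rnorm (l1fun t))%:E) }.

Lemma l1_inj (f g : l1) : (forall t, f t = g t) -> f = g.
Proof.
case: f g => [f pf] [g pg] /= /funext e; subst g; congr EllOne.
exact: Prop_irrelevance.
Qed.

HB.instance Definition _ := gen_eqMixin l1.
HB.instance Definition _ := gen_choiceMixin l1.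

Definition l1_rnorm (f : l1) : R := fine (\esum_(t in [set: T]) (rnorm (f t))%:E).

Lemma l1_fin (f : l1) : \esum_(t in [set: T]) (rnorm (f t))%:E \is a fin_num.
Proof.
have /summableP[M MP] := l1P f.
rewrite ge0_fin_numE; last by apply: esum_ge0 => t _; rewrite lee_fin rnorm_ge0.
by rewrite (le_lt_trans (esum_le_fset MP))// ltry.
Qed.

Lemma l1_fset_le (f : l1) (A : {fset T}) : \sum_(t <- A) rnorm (f t) <= l1_rnorm f.
Proof. by rewrite -lee_fin /l1_rnorm fineK ?l1_fin// sum_fset_le_esum. Qed.

Lemma l1_rnorm_le (f : l1) (M : R) :
  (forall A : {fset T}, \sum_(t <- A) rnorm (f t) <= M) -> l1_rnorm f <= M.
Proof. by move=> h; rewrite -lee_fin /l1_rnorm fineK ?l1_fin// esum_le_fset. Qed.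

Lemma l1_val_le (f : l1) t : rnorm (f t) <= l1_rnorm f.
Proof. by have := l1_fset_le f [fset t]%fset; rewrite big_seq_fset1. Qed.

Lemma l1_rnorm_gt (f : l1) (e : R) : 0 < e ->
  exists A : {fset T}, l1_rnorm f - e < \sum_(t <- A) rnorm (f t).
Proof.
move=> e0; apply: contrapT => /forallNP h.
have : l1_rnorm f <= l1_rnorm f - e.
  by apply: l1_rnorm_le => A; rewrite leNgt; apply/negP/h.
by rewrite lerBrDr gerDl leNgt e0.
Qed.

Fact l1_zero_P : summable [set: T] (fun t => (rnorm (0 : C))%:E).
Proof.
apply/(summableP (fun=> 0)); exists 0 => A.
by rewrite big1// => t _; rewrite rnorm0.
Qed.
Fact l1_add_P (f g : l1) : summable [set: T] (fun t => (rnorm (f t + g t))%:E).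
Proof.
apply/(summableP (fun t => f t + g t)); exists (l1_rnorm f + l1_rnorm g) => A.
apply: le_trans (lerD (l1_fset_le f A) (l1_fset_le g A)).
by rewrite -big_split /= ler_sum// => t _; exact: rnormD.
Qed.
Fact l1_scale_P (a : C) (f : l1) : summable [set: T] (fun t => (rnorm (a * f t))%:E).
Proof.
apply/(summableP (fun t => a * f t)); exists (rnorm a * l1_rnorm f) => A.
rewrite (eq_bigr (fun t => rnorm a * rnorm (f t))); last by move=> t _; exact: rnormM.
by rewrite -mulr_sumr ler_wpM2l ?rnorm_ge0// l1_fset_le.
Qed.
Fact l1_opp_P (f : l1) : summable [set: T] (fun t => (rnorm (- f t))%:E).
Proof.
apply/(summableP (fun t => - f t)); exists (l1_rnorm f) => A.
rewrite (eq_bigr (fun t => rnorm (f t))) ?l1_fset_le// => t _; exact: rnormN.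
Qed.

Definition l1_zero := EllOne l1_zero_P.
Definition l1_add f g := EllOne (l1_add_P f g).
Definition l1_opp f := EllOne (l1_opp_P f).
Definition l1_scale a f := EllOne (l1_scale_P a f).

Fact l1_addA : associative l1_add.
Proof. by move=> f g h; apply: l1_inj => t /=; rewrite addrA. Qed.
Fact l1_addC : commutative l1_add.
Proof. by move=> f g; apply: l1_inj => t /=; rewrite addrC. Qed.
Fact l1_add0 : left_id l1_zero l1_add.
Proof. by move=> f; apply: l1_inj => t /=; rewrite add0r. Qed.
Fact l1_addN : left_inverse l1_zero l1_opp l1_add.
Proof. by move=> f; apply: l1_inj => t /=; rewrite addNr. Qed.
HB.instance Definition _ := GRing.isZmodule.Build l1 l1_addA l1_addC l1_add0 l1_addN.

Fact l1_scaleA a b f : l1_scale a (l1_scale b f) = l1_scale (a * b) f.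
Proof. by apply: l1_inj => t /=; rewrite mulrA. Qed.
Fact l1_scale1 : left_id 1 l1_scale.
Proof. by move=> f; apply: l1_inj => t /=; rewrite mul1r. Qed.
Fact l1_scaleDr : right_distributive l1_scale +%R.
Proof. by move=> a f g; apply: l1_inj => t /=; rewrite mulrDr. Qed.
Fact l1_scaleDl f : {morph l1_scale^~ f : a b / a + b}.
Proof. by move=> a b; apply: l1_inj => t /=; rewrite mulrDl. Qed.
HB.instance Definition _ := GRing.Zmodule_isLmodule.Build C l1
  l1_scaleA l1_scale1 l1_scaleDr l1_scaleDl.

Lemma l1DE (f g : l1) t : (f + g) t = f t + g t. Proof. by []. Qed.
Lemma l1NE (f : l1) t : (- f) t = - f t. Proof. by []. Qed.
Lemma l1BE (f g : l1) t : (f - g) t = f t - g t. Proof. by []. Qed.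
Lemma l1ZE a (f : l1) t : (a *: f) t = a * f t. Proof. by []. Qed.
Lemma l10E t : (0 : l1) t = 0. Proof. by []. Qed.
Lemma l1_sumE (I : Type) (s : seq I) (F : I -> l1) t :
  (\sum_(i <- s) F i) t = \sum_(i <- s) F i t.
Proof. by elim/big_rec2: _ => // i y x _ <-. Qed.

Definition l1_norm (f : l1) : C := (l1_rnorm f)%:C.

Fact l1_normD f g : l1_norm (f + g) <= l1_norm f + l1_norm g.
Proof.
rewrite /l1_norm -rmorphD lecR /=; apply: l1_rnorm_le => A.
apply: le_trans (lerD (l1_fset_le f A) (l1_fset_le g A)).
by rewrite -big_split /= ler_sum// => t _; exact: rnormD.
Qed.
Fact l1_rnormZ (a : C) f : l1_rnorm (a *: f) <= rnorm a * l1_rnorm f.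
Proof.
apply: l1_rnorm_le => A.
rewrite (eq_bigr (fun t => rnorm a * rnorm (f t))); last by move=> t _; exact: rnormM.
by rewrite -mulr_sumr ler_wpM2l ?rnorm_ge0// l1_fset_le.
Qed.
Lemma l1_rnorm_ge0 f : 0 <= l1_rnorm f.
Proof. by have := l1_fset_le f fset0; rewrite big_seq_fset0. Qed.
Fact l1_normZ (a : C) f : l1_norm (a *: f) = `|a| * l1_norm f.
Proof.
rewrite /l1_norm rnormE -rmorphM /=; congr (_%:C); apply/eqP.
rewrite eq_le l1_rnormZ /=; have [->|a0] := eqVneq a 0.
  by rewrite rnorm0 mul0r l1_rnorm_ge0.
rewrite -[in leLHS](scale1r f) -(mulVf a0) -scalerA.
rewrite (le_trans (ler_wpM2l (rnorm_ge0 _) (l1_rnormZ _ _)))//.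
by rewrite mulrA -rnormM mulfV// rnorm1 mul1r.
Qed.
Fact l1_norm0 f : l1_norm f = 0 -> f = 0.
Proof.
by move=> [f0]; apply: l1_inj => t; apply: rnorm_le0; rewrite -f0 l1_val_le.
Qed.
HB.instance Definition _ := Lmodule_isNormed.Build C l1 l1_normD l1_normZ l1_norm0.

Lemma rnorm_l1 f : rnorm f = l1_rnorm f. Proof. by []. Qed.

Fact l1_complete (F : set_system l1) : ProperFilter F -> cauchy F -> cvg F.
Proof.
apply: (@complete_fast _ _ 2) => u uP.
have pos n : (0 : R) < 2^-1 ^+ n by rewrite exprn_gt0// invr_gt0.
have /choice[l lP] : forall t, exists l : C, forall n, rnorm (l - u n t) <= 4 * 2^-1 ^+ n.
  move=> t; apply: fast_cvgC => n; apply: le_trans (uP n).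
  by rewrite -l1BE; exact: l1_val_le.
have step n k : rnorm (u (n + k)%N - u n) <= (2 * 2^-1 ^+ n) * (1 - 2^-1 ^+ k).
  elim: k => [|k IH]; first by rewrite addn0 !subrr rnorm0 mulr0.
  rewrite addnS; apply: (le_trans (rnorm_tri (u (n + k)%N) _ _)).
  have h := uP (n + k)%N; apply: (le_trans (lerD h IH)).
  rewrite exprD exprS !mulrBr; set a := 2^-1 ^+ n; set b := 2^-1 ^+ k; lra.
have step' n k : rnorm (u (n + k)%N - u n) <= 2 * 2^-1 ^+ n.
  by apply: (le_trans (step n k)); have := pos n; have := pos k; nra.
have key n (A : {fset T}) : \sum_(t <- A) rnorm (l t - u n t) <= 2 * 2^-1 ^+ n.
  apply/ler_addgt0Pr => e e0.
  have [k kP] := pow_small (4 * (size A)%:R) e0.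
  have h : \sum_(t <- A) rnorm (u (n + k)%N t - u n t) <= 2 * 2^-1 ^+ n.
    apply: le_trans (step' n k); exact: (l1_fset_le (u (n + k)%N - u n)).
  have h' : \sum_(t <- A) rnorm (l t - u (n + k)%N t) <= e.
    apply: le_trans (ltW kP).
    apply: (@le_trans _ _ (\sum_(t <- A) 4 * 2^-1 ^+ k)).
      apply: ler_sum => t _; apply: (le_trans (lP t _)).
      rewrite exprD ler_pM2l// ler_piMl ?(ltW (pos _))//.
      by rewrite exprn_ile1 ?invr_ge0// invf_le1// ler1n.
    by rewrite big_const_seq count_predT iter_addr_0 -[leLHS]mulr_natr mulrAC.
  rewrite addrC; apply: le_trans (lerD h' h).
  rewrite -big_split /= ler_sum// => t _; exact: rnorm_tri.
have lS : summable [set: T] (fun t => (rnorm (l t))%:E).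
  apply/summableP; exists (2 + l1_rnorm (u 0)) => A.
  apply: (@le_trans _ _ (\sum_(t <- A) (rnorm (l t - u 0 t) + rnorm (u 0 t)))).
    by apply: ler_sum => t _; rewrite -[in leLHS](subrK (u 0 t) (l t)) rnormD.
  rewrite big_split lerD// ?l1_fset_le//.
  by apply: le_trans (key 0 A) _; rewrite expr0 mulr1.
by exists (EllOne lS) => n; apply: l1_rnorm_le => A; exact: key.
Qed.
HB.instance Definition _ := Uniform_isComplete.Build l1 l1_complete.

Fact l1_delta_P t : summable [set: T] (fun s => (rnorm ((s == t)%:R : C))%:E).
Proof.
apply/(summableP (fun s => (s == t)%:R)); exists 1 => A.
have [tA|tA] := boolP (t \in A).
  rewrite (big_fsetD1 t)//= eqxx rnorm1 big1_fset ?addr0// => s.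
  by rewrite !inE => /andP[/negbTE -> _] _; rewrite rnorm0.
rewrite big1_fset// => s sA _; case: eqP => [st|_]; last by rewrite rnorm0.
by rewrite -st sA in tA.
Qed.
Definition delta t := EllOne (l1_delta_P t).

Lemma rnorm_delta t : rnorm (delta t) = 1.
Proof.
apply/eqP; rewrite eq_le; apply/andP; split; last first.
  by have := l1_val_le (delta t) t; rewrite /= eqxx rnorm1.
apply: l1_rnorm_le => A; have [tA|tA] := boolP (t \in A).
  rewrite (big_fsetD1 t)//= eqxx rnorm1 big1_fset ?addr0// => s.
  by rewrite !inE => /andP[/negbTE -> _] _; rewrite rnorm0.
rewrite big1_fset// => s sA _ /=; case: eqP => [st|_]; last by rewrite rnorm0.
by rewrite -st sA in tA.
Qed.

Lemma l1_fset_sumE (f : l1) (A : {fset T}) s :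
  (\sum_(t <- A) f t *: delta t) s = if s \in A then f s else 0.
Proof.
rewrite l1_sumE; have [sA|sA] := boolP (s \in A).
  rewrite (big_fsetD1 s)//= eqxx mulr1 big1_fset ?addr0// => t.
  by rewrite !inE eq_sym => /andP[/negbTE -> _] _; rewrite mulr0.
rewrite big1_fset// => t tA _ /=; case: eqP => [st|_]; last by rewrite mulr0.
by rewrite st tA in sA.
Qed.

Lemma big_fset_split (V : zmodType) (A B : {fset T}) (F : T -> V) :
  (A `<=` B)%fset ->
  \sum_(t <- B) F t = \sum_(t <- A) F t + \sum_(t <- (B `\` A)%fset) F t.
Proof.
move=> AB; rewrite (big_fsetID _ (mem A)); congr (_ + _).
  by apply: eq_fbigl => t; rewrite !inE/= andbC; case tA: (t \in A) => //=; rewrite (fsubsetP AB _ tA).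
by apply: eq_fbigl => t; rewrite !inE/= andbC.
Qed.

Lemma l1_approx (f : l1) (e : R) : 0 < e -> exists A : {fset T},
  rnorm (f - \sum_(t <- A) f t *: delta t) <= e /\
  forall B : {fset T}, (A `<=` B)%fset -> \sum_(t <- (B `\` A)%fset) rnorm (f t) <= e.
Proof.
move=> e0; have [A AP] := l1_rnorm_gt f e0; exists A.
have tail (B : {fset T}) : (A `<=` B)%fset -> \sum_(t <- (B `\` A)%fset) rnorm (f t) <= e.
  by move=> AB; have := l1_fset_le f B; rewrite (big_fset_split _ AB) => h; lra.
split=> //; apply: l1_rnorm_le => B.
rewrite (eq_bigr (fun t => if t \in A then 0 else rnorm (f t))); last first.
  move=> t _; rewrite l1BE l1_fset_sumE; case: ifP => _.
    by rewrite subrr rnorm0.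
  by rewrite subr0.
rewrite (big_fsetID _ (mem A))/= [X in X + _]big1_fset ?add0r; last first.
  by move=> t; rewrite !inE => /andP[_ ->].
apply: le_trans (tail (A `|` B)%fset (fsubsetUl _ _)).
rewrite (@eq_fbigl _ _ _ _ _ ((A `|` B) `\` A)%fset); last first.
  by move=> t; rewrite !inE/=; case: (t \in A); rewrite ?andbF ?andbT.
by rewrite ler_sum// => t _; case: ifP => // _; exact: rnorm_ge0.
Qed.

End EllOneType.

#[local] Existing Instance summability.totally_filter.

Section EllOneLift.
Context {R : realType} {T : choiceType}.
Local Notation C := R[i].

Definition l1_lift {W : normedModType C} (phi : T -> W) (f : l1 R T) : W :=
  summability.sum (fun t => f t *: phi t).

Section Theory.
Context {W : completeNormedModType C} (phi : T -> W) (M : R).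
Hypothesis phiM : forall t, rnorm (phi t) <= M.

Lemma l1_lift_tail (f : l1 R T) (A : {fset T}) :
  rnorm (\sum_(t <- A) f t *: phi t) <= M * \sum_(t <- A) rnorm (f t).
Proof.
rewrite (le_trans (rnorm_sum _ _ _))// mulr_sumr ler_sum// => t _.
by rewrite rnormZ mulrC ler_wpM2r ?rnorm_ge0.
Qed.

Lemma partial_sumE (x : T -> W) (A : {fset T}) :
  summability.partial_sum x A = \sum_(t <- A) x t.
Proof. by rewrite [RHS]big_seq_fsetE. Qed.

Lemma l1_lift_approx (f : l1 R T) (e : R) : 0 < e -> exists A : {fset T},
  forall B : {fset T}, (A `<=` B)%fset ->
    rnorm (\sum_(t <- B) f t *: phi t - \sum_(t <- A) f t *: phi t) <= e.
Proof.
move=> e0; have M1 : 0 < `|M| + 1 by rewrite ltr_wpDl.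
have e2 : 0 < e / (`|M| + 1) by rewrite divr_gt0.
have [A [_ AP]] := l1_approx f e2.
exists A => B AB; rewrite (big_fset_split _ AB) addrAC subrr add0r.
rewrite (le_trans (l1_lift_tail _ _))//.
have := AP _ AB; set S := \sum_(_ <- _) _ => h.
have S0 : 0 <= S by apply: sumr_ge0 => t _; exact: rnorm_ge0.
apply: (@le_trans _ _ ((`|M| + 1) * S)).
  by rewrite ler_wpM2r// (le_trans (ler_norm _))// lerDl.
by rewrite mulrC -ler_pdivlMr.
Qed.

Lemma l1_lift_cvg (f : l1 R T) :
  summability.partial_sum (fun t => f t *: phi t) @ summability.totally
    --> l1_lift phi f.
Proof.
apply/cauchy_cvgP; apply: cauchy_exP => e e0; have [eE r0] := pos_complexE e0.
have r2 : 0 < complex.Re e / 2 by rewrite divr_gt0.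
have [A AP] := l1_lift_approx f r2.
exists (\sum_(t <- A) f t *: phi t); exists A => // B /= AB.
rewrite -ball_normE /= rnormE eE ltcR partial_sumE rnormC.
by apply: (le_lt_trans (AP _ AB)); lra.
Qed.

Lemma l1_lift_near (f : l1 R T) (e : R) : 0 < e -> exists A : {fset T},
  forall B : {fset T}, (A `<=` B)%fset ->
    rnorm (l1_lift phi f - \sum_(t <- B) f t *: phi t) <= e.
Proof.
move=> e0; have e0' : 0 < (e%:C : C) by rewrite ltcR.
have /cvgrPdist_le/(_ _ e0')[A _ AP] := @l1_lift_cvg f.
by exists A => B AB; have := AP B AB; rewrite /= rnormE lecR partial_sumE.
Qed.

Lemma l1_lift_linear : linear (l1_lift phi).
Proof.
move=> a f g; apply/eqP; rewrite -subr_eq0; apply/eqP/rnorm_le0.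
apply/ler_addgt0Pr => e e0; rewrite add0r.
have a1 : 0 < rnorm a + 2 by rewrite ltr_wpDl// rnorm_ge0.
have d0 : 0 < e / (rnorm a + 2) by rewrite divr_gt0.
set d := e / _ in d0; have [A1 AP1] := l1_lift_near (a *: f + g) d0.
have [A2 AP2] := l1_lift_near f d0; have [A3 AP3] := l1_lift_near g d0.
pose B := (A1 `|` (A2 `|` A3))%fset.
have h1 := AP1 B (fsubsetUl _ _).
have h2 := AP2 B (fsubset_trans (fsubsetUl _ _) (fsubsetUr _ _)).
have h3 := AP3 B (fsubset_trans (fsubsetUr _ _) (fsubsetUr _ _)).
have sE : \sum_(t <- B) (a *: f + g) t *: phi t =
    a *: (\sum_(t <- B) f t *: phi t) + \sum_(t <- B) g t *: phi t.
  rewrite scaler_sumr -big_split; apply: eq_bigr => t _ /=.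
  by rewrite scalerDl scalerA.
rewrite sE in h1.
move: h1 h2 h3; set SF := \sum_(_ <- _) f _ *: _; set SG := \sum_(_ <- _) g _ *: _.
move=> h1 h2 h3.
apply: (le_trans (rnorm_tri (a *: SF + SG) _ _)).
have -> : a *: SF + SG - (a *: l1_lift phi f + l1_lift phi g) =
    a *: (SF - l1_lift phi f) + (SG - l1_lift phi g).
  by rewrite scalerBr opprD addrACA.
have eE : d * (rnorm a + 2) = e by rewrite /d divfK// gt_eqF.
have := rnormD (a *: (SF - l1_lift phi f)) (SG - l1_lift phi g).
rewrite rnormZ (rnormC SF) (rnormC SG).
have : rnorm a * rnorm (l1_lift phi f - SF) <= rnorm a * d.
  by rewrite ler_wpM2l ?rnorm_ge0.
by move=> h4 h5; lra.
Qed.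

Lemma l1_lift_bound f : rnorm (l1_lift phi f) <= M * rnorm f.
Proof.
have [[t _]|h] := pselect (exists t : T, True).
  have M0 : 0 <= M by apply: le_trans (phiM t); exact: rnorm_ge0.
  apply/ler_addgt0Pr => e e0; have [A AP] := l1_lift_near f e0.
  have h1 := AP _ (fsubset_refl A); have h2 := l1_lift_tail f A.
  have h3 : M * \sum_(t <- A) rnorm (f t) <= M * rnorm f.
    by rewrite ler_wpM2l// l1_fset_le.
  rewrite -[l1_lift phi f](subrK (\sum_(t <- A) f t *: phi t)).
  by apply: (le_trans (rnormD _ _)); lra.
have -> : f = 0 by apply: l1_inj => t; case: h; exists t.
by rewrite (lin0 l1_lift_linear) !rnorm0 mulr0.
Qed.

Lemma l1_lift_bl : bounded_linear (l1_lift phi).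
Proof. by split; [exact: l1_lift_linear|exists M; exact: l1_lift_bound]. Qed.

Lemma l1_lift_delta t : l1_lift phi (delta R t) = phi t.
Proof.
apply/eqP; rewrite -subr_eq0; apply/eqP/rnorm_le0.
apply/ler_addgt0Pr => e e0; rewrite add0r.
have [A AP] := l1_lift_near (delta R t) e0.
have := AP (t |` A)%fset (fsubsetUr _ _).
rewrite (big_fsetD1 t) ?fset1U1//= eqxx scale1r big1_fset ?addr0// => s.
by rewrite !inE => /andP[/negbTE -> _] _; rewrite scale0r.
Qed.
End Theory.

Lemma l1_ext (W : normedModType C) (f g : l1 R T -> W) :
  bounded_linear f -> bounded_linear g ->
  (forall t, f (delta R t) = g (delta R t)) -> forall x, f x = g x.
Proof.
move=> fb gb fg x; apply/eqP; rewrite -subr_eq0; apply/eqP.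
have hb := bl_lincomb (-1) gb fb; have [lh _] := hb.
have [M M0 MP] := bl_bound hb.
apply/rnorm_le0/ler_addgt0Pr => e e0; rewrite add0r.
have d0 : 0 < e / (M + 1) by rewrite divr_gt0// ltr_wpDl.
have [A [AP _]] := l1_approx x d0.
have := MP (x - \sum_(t <- A) x t *: delta R t).
rewrite (linB lh) (lin_sum lh) big1 ?subr0; last first.
  by move=> t _; rewrite (linZ lh) fg scaleN1r addNr scaler0.
rewrite scaleN1r [- _ + _]addrC => h; apply: (le_trans h).
rewrite (le_trans (ler_wpM2l M0 AP))// mulrA ler_pdivrMr ?ltr_wpDl// mulrC.
by rewrite ler_pM2l// lerDl.
Qed.

End EllOneLift.

(* The projective tensor product, realised as the quotient of ell^1(X * Y) in
   which (`|x| `|y|) delta_(x, y) becomes bilinear in (x, y). The lemmas tens_bb,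
   rnorm_tens, ptens_univ and ptens_ext give its universal property, which
   determines it up to isometric isomorphism. *)
Section ProjectiveTensor.
Context {R : realType}.
Local Notation C := R[i].
Context (X Y : completeNormedModType C).

Definition etens (x : X) (y : Y) : l1 R (X * Y)%type :=
  (`|x| * `|y|) *: delta R (x, y).

Variant tens_rel : l1 R (X * Y)%type -> Prop :=
| TensRelL (a : C) x x' y :
    tens_rel (etens (a *: x + x') y - (a *: etens x y + etens x' y))
| TensRelR (a : C) x y y' :
    tens_rel (etens x (a *: y + y') - (a *: etens x y + etens x y'))
| TensRel0L y : tens_rel (delta R (0, y))
| TensRel0R x : tens_rel (delta R (x, 0)).

Definition ptens : completeNormedModType C := quotban (cspan tens_rel).

Definition tens (x : X) (y : Y) : ptens := qpi (cspan tens_rel) (etens x y).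

Lemma rnorm_tens x y : rnorm (tens x y) <= rnorm x * rnorm y.
Proof.
apply: (le_trans (rnorm_qpi _ _)); rewrite rnormZ rnorm_delta mulr1.
by rewrite !rnormE -rmorphM rnormR ger0_norm ?mulr_ge0 ?rnorm_ge0.
Qed.

Lemma tens_bb : bounded_bilinear tens.
Proof.
split.
- move=> y a x x'; rewrite /tens -qpiZ -qpiD; apply/qpi_eq/sub_cspan.
  exact: TensRelL.
- move=> x a y y'; rewrite /tens -qpiZ -qpiD; apply/qpi_eq/sub_cspan.
  exact: TensRelR.
- by exists 1 => x y; rewrite mul1r rnorm_tens.
Qed.

Lemma ptens_univ (W : completeNormedModType C) (b : X -> Y -> W) (M : R) :
  0 <= M -> bounded_bilinear b ->
  (forall x y, rnorm (b x y) <= M * (rnorm x * rnorm y)) ->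
  exists g : ptens -> W, [/\ linear g, forall t, rnorm (g t) <= M * rnorm t
    & forall x y, g (tens x y) = b x y].
Proof.
move=> M0 [l1b l2b _] bM.
pose phi (z : X * Y) : W := (`|z.1| * `|z.2|)^-1 *: b z.1 z.2.
have phiM z : rnorm (phi z) <= M.
  rewrite /phi !rnormE -rmorphM -fmorphV rnormZ rnormR ger0_norm; last first.
    by rewrite invr_ge0 mulr_ge0 ?rnorm_ge0.
  have [->|n0] := eqVneq (rnorm z.1 * rnorm z.2) 0; first by rewrite invr0 mul0r.
  rewrite mulrC ler_pdivrMr ?bM// lt_def n0 mulr_ge0 ?rnorm_ge0//.
have b0l y : b 0 y = 0 by have := lin0 (l1b y).
have b0r x : b x 0 = 0 by have := lin0 (l2b x).
have phiE x y : l1_lift phi (etens x y) = b x y.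
  rewrite /etens (linZ (l1_lift_linear phiM)) (l1_lift_delta phiM) /phi /= scalerA.
  have [->|x0] := eqVneq x 0; first by rewrite b0l scaler0.
  have [->|y0] := eqVneq y 0; first by rewrite b0r scaler0.
  by rewrite mulfV ?scale1r// mulf_neq0 ?normr_eq0.
have [] := @quotban_lift R _ (cspan tens_rel) W (l1_lift phi) M
  (l1_lift_linear phiM) (l1_lift_bound phiM).
  move=> x; apply: cspan_ker; first exact: l1_lift_bl phiM.
  have lphi := l1_lift_linear phiM.
  move=> _ [a u u' y|a u y y'|y|u].
  - by rewrite (linB lphi) lphi !phiE l1b subrr.
  - by rewrite (linB lphi) lphi !phiE l2b subrr.
  - by rewrite (l1_lift_delta phiM) /phi /= b0l scaler0.
  - by rewrite (l1_lift_delta phiM) /phi /= b0r scaler0.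
move=> g [lg gM gE]; exists g; split=> // x y.
by rewrite /tens gE phiE.
Qed.

Lemma ptens_ext (W : normedModType C) (f g : ptens -> W) :
  bounded_linear f -> bounded_linear g ->
  (forall x y, f (tens x y) = g (tens x y)) -> forall t, f t = g t.
Proof.
move=> fb gb fg t; have [u <-] := qpi_surj t.
apply: (l1_ext (bl_comp fb (qpi_bl _)) (bl_comp gb (qpi_bl _))) => -[x y].
have ker (h : ptens -> W) (hb : bounded_linear h) : x = 0 \/ y = 0 ->
    h (qpi _ (delta R (x, y))) = 0.
  have [lh _] := hb; move=> xy; rewrite (_ : qpi _ _ = 0) ?(lin0 lh)//.
  by apply/qpi_eq0/sub_cspan; case: xy => ->; constructor.
have [x0|x0] := eqVneq x 0; first by rewrite !ker; auto.
have [y0|y0] := eqVneq y 0; first by rewrite !ker; auto.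
have -> : delta R (x, y) = (`|x| * `|y|)^-1 *: etens x y.
  by rewrite scalerA mulVf ?scale1r// mulf_neq0 ?normr_eq0.
by rewrite qpiZ (linZ (proj1 fb)) (linZ (proj1 gb)); congr (_ *: _); exact: fg.
Qed.

End ProjectiveTensor.

Section BanachAlgebras.
Context (R : realType).
Local Notation C := R[i].

Record banachAlg := BanachAlg {
  ba_car :> completeNormedModType C;
  amul : ba_car -> ba_car -> ba_car;
  amul_linl : forall y, linear (fun x => amul x y);
  amul_linr : forall x, linear (amul x);
  amulA : forall x y z, amul x (amul y z) = amul (amul x y) z;
  amul_norm : forall x y, `|amul x y| <= `|x| * `|y| }.

Lemma amul_rnorm (A : banachAlg) (x y : A) : rnorm (amul x y) <= rnorm x * rnorm y.
Proof. by have := amul_norm x y; rewrite !rnormE -rmorphM lecR. Qed.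

Lemma amul_bb (A : banachAlg) : bounded_bilinear (@amul A).
Proof.
split; [exact: amul_linl|exact: amul_linr|].
by exists 1 => x y; rewrite mul1r amul_rnorm.
Qed.

(* The actions are bounded, not necessarily contractive, and no nondegeneracy
   is assumed. *)
Record bimod (A B : banachAlg) := Bimod {
  bm_car :> completeNormedModType C;
  lact : A -> bm_car -> bm_car;
  ract : bm_car -> B -> bm_car;
  lact_bb : bounded_bilinear lact;
  ract_bb : bounded_bilinear ract;
  lactA : forall a a' x, lact (amul a a') x = lact a (lact a' x);
  ractA : forall x b b', ract x (amul b b') = ract (ract x b) b';
  lractA : forall a x b, ract (lact a x) b = lact a (ract x b) }.

Program Definition reg (A : banachAlg) : bimod A A :=
  @Bimod A A A (@amul A) (@amul A) (amul_bb A) (amul_bb A) _ _ _.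
Next Obligation. by move=> A a a' x; rewrite amulA. Qed.
Next Obligation. by move=> A x b b'; rewrite amulA. Qed.
Next Obligation. by move=> A a x b; rewrite amulA. Qed.

Definition bimod_iso (A B : banachAlg) (X Y : bimod A B) (f : X -> Y) : Prop :=
  [/\ banach_iso f, forall a x, f (lact a x) = lact a (f x)
    & forall x b, f (ract x b) = ract (f x) b].

Definition balanced_module_map (A B D : banachAlg) (X : bimod A B) (Y : bimod B D)
    (Z : bimod A D) (f : X -> Y -> Z) : Prop :=
  [/\ bounded_bilinear f,
      forall x b y, f (ract x b) y = f x (lact b y),
      forall a x y, f (lact a x) y = lact a (f x y)
    & forall x y d, f x (ract y d) = ract (f x y) d].

End BanachAlgebras.
Arguments reg {R} A.

Section BalancedTensor.
Context {R : realType}.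
Local Notation C := R[i].
Context {A B D : banachAlg R} (X : bimod A B) (Y : bimod B D).

Variant bal_rel : ptens X Y -> Prop :=
| BalRel x b y : bal_rel (tens (ract x b) y - tens x (lact b y)).

Definition btens_car : completeNormedModType C := quotban (cspan bal_rel).

Definition btens_elt (x : X) (y : Y) : btens_car := qpi (cspan bal_rel) (tens x y).

Lemma btens_elt_bb : bounded_bilinear btens_elt.
Proof. exact: bb_comp (qpi_bl _) (tens_bb X Y). Qed.

Lemma rnorm_btens_elt x y : rnorm (btens_elt x y) <= rnorm x * rnorm y.
Proof. exact: le_trans (rnorm_qpi _ _) (rnorm_tens x y). Qed.

Lemma btens_elt_bal x b y : btens_elt (ract x b) y = btens_elt x (lact b y).
Proof. by apply/qpi_eq/sub_cspan. Qed.

Lemma btens_univ (W : completeNormedModType C) (f : X -> Y -> W) (M : R) :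
  0 <= M -> bounded_bilinear f ->
  (forall x y, rnorm (f x y) <= M * (rnorm x * rnorm y)) ->
  (forall x b y, f (ract x b) y = f x (lact b y)) ->
  exists g : btens_car -> W, [/\ linear g, forall t, rnorm (g t) <= M * rnorm t
    & forall x y, g (btens_elt x y) = f x y].
Proof.
move=> M0 fb fM fbal; have [h [lh hM hE]] := ptens_univ M0 fb fM.
have [] := @quotban_lift R _ (cspan bal_rel) W h M lh hM.
  move=> t; apply: cspan_ker; first by split=> //; exists M.
  by move=> _ [x b y]; rewrite (linB lh) !hE fbal subrr.
move=> g [lg gM gE]; exists g; split=> // x y.
by rewrite /btens_elt gE hE.
Qed.

Lemma btens_ext (W : normedModType C) (f g : btens_car -> W) :
  bounded_linear f -> bounded_linear g ->
  (forall x y, f (btens_elt x y) = g (btens_elt x y)) -> forall t, f t = g t.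
Proof.
move=> fb gb fg t; have [u <-] := qpi_surj t.
exact: (ptens_ext (bl_comp fb (qpi_bl _)) (bl_comp gb (qpi_bl _))).
Qed.

Lemma btens_lact_ex (a : A) : exists g : btens_car -> btens_car,
  bounded_linear g /\ forall x y, g (btens_elt x y) = btens_elt (lact a x) y.
Proof.
have fb : bounded_bilinear (fun x y => btens_elt (lact a x) y).
  apply: (bb_compl (f := lact a) (bb_right a (lact_bb X)) btens_elt_bb).
have [M M0 MP] := bb_bound fb.
have [|g [lg gM gE]] := btens_univ M0 fb MP.
  by move=> x b y; rewrite -lractA btens_elt_bal.
by exists g; split=> //; split=> //; exists M.
Qed.

Lemma btens_ract_ex (d : D) : exists g : btens_car -> btens_car,
  bounded_linear g /\ forall x y, g (btens_elt x y) = btens_elt x (ract y d).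
Proof.
have fb : bounded_bilinear (fun x y => btens_elt x (ract y d)).
  apply: (bb_compr (f := fun y => ract y d) (bb_left d (ract_bb Y)) btens_elt_bb).
have [M M0 MP] := bb_bound fb.
have [|g [lg gM gE]] := btens_univ M0 fb MP.
  by move=> x b y; rewrite lractA btens_elt_bal.
by exists g; split=> //; split=> //; exists M.
Qed.

(* By btens_ext these maps are the only possible choices. *)
Definition btens_lact (a : A) : btens_car -> btens_car := sval (cid (btens_lact_ex a)).
Definition btens_ract (t : btens_car) (d : D) : btens_car :=
  sval (cid (btens_ract_ex d)) t.

Lemma btens_lact_bl a : bounded_linear (btens_lact a).
Proof. by rewrite /btens_lact; case: cid => g []. Qed.
Lemma btens_lactE a x y : btens_lact a (btens_elt x y) = btens_elt (lact a x) y.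
Proof. by rewrite /btens_lact; case: cid => g []. Qed.
Lemma btens_ract_bl d : bounded_linear (btens_ract^~ d).
Proof. by rewrite /btens_ract; case: cid => g []. Qed.
Lemma btens_ractE x y d : btens_ract (btens_elt x y) d = btens_elt x (ract y d).
Proof. by rewrite /btens_ract; case: cid => g []. Qed.

Fact btens_lact_bb : bounded_bilinear btens_lact.
Proof.
split.
- move=> t c a a'; move: t; apply: btens_ext; first exact: btens_lact_bl.
    by apply: bl_lincomb; exact: btens_lact_bl.
  move=> x y; rewrite !btens_lactE; have [l _ _] := lact_bb X.
  by rewrite l; have [l' _ _] := btens_elt_bb; rewrite l'.
- by move=> a; have [] := btens_lact_bl a.
have [M M0 MP] := bb_bound (lact_bb X).
exists M => a t.
have fb : bounded_bilinear (fun x y => btens_elt (lact a x) y).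
  apply: (bb_compl (f := lact a) (bb_right a (lact_bb X)) btens_elt_bb).
have [|||g [lg gM gE]] := @btens_univ _ (fun x y => btens_elt (lact a x) y)
   (M * rnorm a) _ fb.
- by rewrite mulr_ge0 ?rnorm_ge0.
- move=> x y; apply: (le_trans (rnorm_btens_elt _ _)).
  by rewrite mulrA ler_wpM2r ?rnorm_ge0// -mulrA MP.
- by move=> x b y; rewrite -lractA btens_elt_bal.
rewrite (@btens_ext _ (btens_lact a) g) ?mulrA ?gM//.
- exact: btens_lact_bl.
- by split=> //; exists (M * rnorm a).
- by move=> x y; rewrite btens_lactE gE.
Qed.

Fact btens_ract_bb : bounded_bilinear btens_ract.
Proof.
split.
- by move=> d; have [] := btens_ract_bl d.
- move=> t c d d'; move: t; apply: btens_ext; first exact: btens_ract_bl.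
    by apply: bl_lincomb; exact: btens_ract_bl.
  move=> x y; rewrite !btens_ractE; have [_ l _] := ract_bb Y.
  by rewrite l; have [_ l' _] := btens_elt_bb; rewrite l'.
have [M M0 MP] := bb_bound (ract_bb Y).
exists M => t d.
have fb : bounded_bilinear (fun x y => btens_elt x (ract y d)).
  apply: (bb_compr (f := fun y => ract y d) (bb_left d (ract_bb Y)) btens_elt_bb).
have [|||g [lg gM gE]] := @btens_univ _ (fun x y => btens_elt x (ract y d))
   (M * rnorm d) _ fb.
- by rewrite mulr_ge0 ?rnorm_ge0.
- move=> x y; apply: (le_trans (rnorm_btens_elt _ _)).
  rewrite mulrCA ler_wpM2l ?rnorm_ge0//.
  by rewrite (le_trans (MP _ _))// -mulrA (mulrC (rnorm d)).
- by move=> x b y; rewrite lractA btens_elt_bal.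
rewrite (@btens_ext _ (btens_ract^~ d) g).
- by rewrite (le_trans (gM _))// -mulrA (mulrC (rnorm d)).
- exact: btens_ract_bl.
- by split=> //; exists (M * rnorm d).
- by move=> x y; rewrite btens_ractE gE.
Qed.

Fact btens_lactA a a' t : btens_lact (amul a a') t = btens_lact a (btens_lact a' t).
Proof.
move: t; apply: btens_ext; first exact: btens_lact_bl.
  by apply: bl_comp; exact: btens_lact_bl.
by move=> x y; rewrite !btens_lactE lactA.
Qed.
Fact btens_ractA t d d' : btens_ract t (amul d d') = btens_ract (btens_ract t d) d'.
Proof.
move: t; apply: btens_ext; first exact: btens_ract_bl.
  by apply: (bl_comp (f := btens_ract^~ d')); exact: btens_ract_bl.
by move=> x y; rewrite !btens_ractE ractA.
Qed.
Fact btens_lractA a t d :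
  btens_ract (btens_lact a t) d = btens_lact a (btens_ract t d).
Proof.
move: t; apply: btens_ext.
- by apply: (bl_comp (f := btens_ract^~ d)); [exact: btens_ract_bl|exact: btens_lact_bl].
- by apply: bl_comp; [exact: btens_lact_bl|exact: btens_ract_bl].
- by move=> x y; rewrite !(btens_ractE, btens_lactE).
Qed.

Definition btens : bimod A D :=
  @Bimod R A D btens_car btens_lact btens_ract btens_lact_bb btens_ract_bb
    btens_lactA btens_ractA btens_lractA.

End BalancedTensor.

Section Morita.
Context {R : realType}.

(* A (x)_A X (x)_B B is bracketed as (A (x)_A X) (x)_B B. *)
Definition induced (A B : banachAlg R) (X : bimod A B) : Prop :=
  exists f : btens (btens (reg A) X) (reg B) -> X,
    bimod_iso f /\
    forall (a : A) (x : X) (b : B),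
      f (btens_elt (X := btens (reg A) X) (Y := reg B)
           (btens_elt (X := reg A) (Y := X) a x) b) = ract (lact a x) b.

Definition self_induced (A : banachAlg R) : Prop := induced (reg A).

Definition implements_iso (A B D : banachAlg R) (X : bimod A B) (Y : bimod B D)
    (Z : bimod A D) (f : X -> Y -> Z) : Prop :=
  exists phi : btens X Y -> Z,
    bimod_iso phi /\ forall x y, phi (btens_elt x y) = f x y.

Record morita_equivalence (A B : banachAlg R) (P : bimod B A) (Q : bimod A B)
    (brB : P -> Q -> reg B) (brA : Q -> P -> reg A) : Prop := MoritaEquivalence {
  morita_selfA : self_induced A;
  morita_selfB : self_induced B;
  morita_indP : induced P;
  morita_indQ : induced Q;
  morita_brB : balanced_module_map brB;
  morita_brA : balanced_module_map brA;
  morita_isoB : implements_iso brB;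
  morita_isoA : implements_iso brA;
  morita_assocP : forall p q p', lact (brB p q) p' = ract p (brA q p');
  morita_assocQ : forall q p q', ract q (brB p q') = lact (brA q p) q' }.

Definition morita_equivalent (A B : banachAlg R) : Prop :=
  exists (P : bimod B A) (Q : bimod A B) brB brA, @morita_equivalence A B P Q brB brA.

End Morita.

Section SemigroupAlgebra.
Context (R : realType) (T : semigroupType).
Local Notation C := R[i].

(* f * g = \sum_s f s \sum_t g t delta_(s t). *)
Definition conv (f g : l1 R T) : l1 R T :=
  l1_lift (fun s => l1_lift (fun t => delta R (s * t)%g) g) f.

Lemma conv_inner_bound (g : l1 R T) (s : T) :
  rnorm (l1_lift (fun t => delta R (s * t)%g) g) <= rnorm g.
Proof.
have h t : rnorm (delta R (s * t)%g) <= 1 by rewrite rnorm_delta.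
by have := l1_lift_bound h g; rewrite mul1r.
Qed.

Lemma rnorm_conv f g : rnorm (conv f g) <= rnorm f * rnorm g.
Proof. by rewrite mulrC; exact: l1_lift_bound (conv_inner_bound g) f. Qed.

Fact conv_linl g : linear (conv^~ g).
Proof. exact: l1_lift_linear (conv_inner_bound g). Qed.

Lemma conv_deltal s g : conv (delta R s) g = l1_lift (fun t => delta R (s * t)%g) g.
Proof. exact: l1_lift_delta (conv_inner_bound g) s. Qed.

Lemma conv_blinl g : bounded_linear (conv^~ g).
Proof. exact: l1_lift_bl (conv_inner_bound g). Qed.

Fact conv_linr f : linear (conv f).
Proof.
move=> a g h; move: f; apply: l1_ext; first exact: conv_blinl.
  by apply: bl_lincomb; exact: conv_blinl.
move=> s; rewrite !conv_deltal.
have b t : rnorm (delta R (s * t)%g) <= 1 by rewrite rnorm_delta.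
exact: (l1_lift_linear b).
Qed.

Lemma conv_blinr f : bounded_linear (conv f).
Proof. by split; [exact: conv_linr|exists (rnorm f) => g; exact: rnorm_conv]. Qed.

Lemma conv_delta s t : conv (delta R s) (delta R t) = delta R (s * t)%g.
Proof.
have b u : rnorm (delta R (s * u)%g) <= 1 by rewrite rnorm_delta.
by rewrite conv_deltal (l1_lift_delta b).
Qed.

Fact convA f g h : conv f (conv g h) = conv (conv f g) h.
Proof.
move: f; apply: l1_ext; first exact: conv_blinl.
  by apply: (bl_comp (f := conv^~ h)); exact: conv_blinl.
move=> s; move: g; apply: l1_ext.
- by apply: (bl_comp (f := conv _)); [exact: conv_blinr|exact: conv_blinl].
- by apply: (bl_comp (f := conv^~ h)); [exact: conv_blinl|exact: conv_blinr].
move=> t; move: h; apply: l1_ext.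
- by apply: (bl_comp (f := conv _)); exact: conv_blinr.
- exact: conv_blinr.
by move=> u; rewrite !conv_delta mulgA.
Qed.

Fact conv_norm f g : `|conv f g| <= `|f| * `|g|.
Proof. by rewrite !rnormE -rmorphM lecR rnorm_conv. Qed.

Definition l1alg : banachAlg R := BanachAlg conv_linl conv_linr convA conv_norm.

End SemigroupAlgebra.

Section QuotientAlgebra.
Context {R : realType}.
Local Notation C := R[i].

Record closed_ideal (A : banachAlg R) := ClosedIdeal {
  ideal_csub :> csubspace A;
  ideall : forall a x, ideal_csub x -> ideal_csub (amul a x);
  idealr : forall a x, ideal_csub x -> ideal_csub (amul x a) }.

Context {A : banachAlg R} (J : closed_ideal A).
Local Notation pi := (qpi J).

Definition qmul (p q : quotban J) : quotban J := pi (amul (repr p) (repr q)).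

Lemma qmulE x y : qmul (pi x) (pi y) = pi (amul x y).
Proof.
apply/qpi_eq; set x' := repr _; set y' := repr _.
have -> : amul x' y' - amul x y = amul (x' - x) y' + amul x (y' - y).
  by rewrite (linB (amul_linl y')) (linB (amul_linr x)) addrA subrK.
apply: csubD; [apply: idealr|apply: ideall]; exact: qpi_repr.
Qed.

Fact qmul_linl q : linear (qmul^~ q).
Proof.
move=> a p p'; have [[[x <-] [x' <-]] [y <-]] := (qpi_surj p, qpi_surj p', qpi_surj q).
by rewrite -qpiZ -qpiD !qmulE amul_linl qpiD qpiZ.
Qed.
Fact qmul_linr p : linear (qmul p).
Proof.
move=> a q q'; have [[[x <-] [y <-]] [y' <-]] := (qpi_surj p, qpi_surj q, qpi_surj q').
by rewrite -qpiZ -qpiD !qmulE amul_linr qpiD qpiZ.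
Qed.
Fact qmulA p q r : qmul p (qmul q r) = qmul (qmul p q) r.
Proof.
have [[[x <-] [y <-]] [z <-]] := (qpi_surj p, qpi_surj q, qpi_surj r).
by rewrite !qmulE amulA.
Qed.
Fact qmul_norm p q : `|qmul p q| <= `|p| * `|q|.
Proof.
rewrite !rnormE -rmorphM lecR /=; apply/ler_addgt0Pr => e e0.
pose k := rnorm p + rnorm q + 1.
have k0 : 0 < k by rewrite ltr_wpDl ?addr_ge0 ?rnorm_ge0.
pose d := Num.min 1 (e / k).
have d0 : 0 < d by rewrite /d lt_min ltr01 divr_gt0.
have d1 : d <= 1 by rewrite /d ge_min lexx.
have dk : d * k <= e by rewrite -ler_pdivlMr// /d ge_min lexx orbT.
have [x xp xd] := qpi_lift p d0; have [y yq yd] := qpi_lift q d0.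
rewrite -[in leLHS]xp -[in leLHS]yq qmulE (le_trans (rnorm_qpi _ _))//.
rewrite (le_trans (amul_rnorm _ _))//.
apply: (le_trans (ler_pM (rnorm_ge0 _) (rnorm_ge0 _) (ltW xd) (ltW yd))).
have := rnorm_ge0 p; have := rnorm_ge0 q; move: dk; rewrite /k.
move: (rnorm p) (rnorm q) => s t; nra.
Qed.

Definition quotalg : banachAlg R := BanachAlg qmul_linl qmul_linr qmulA qmul_norm.

End QuotientAlgebra.

Section ReducedAlgebra.
Context (R : realType) (T : semigroupType) (z : T).
Local Notation C := R[i].
Hypothesis zl : forall t, (z * t)%g = z.
Hypothesis zr : forall t, (t * z)%g = z.

Definition zero_set : set (l1alg R T) := [set f | exists c : C, f = c *: delta R z].

Fact zero_set0 : zero_set 0. Proof. by exists 0; rewrite scale0r. Qed.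
Fact zero_setP (a : C) x y : zero_set x -> zero_set y -> zero_set (a *: x + y).
Proof. by move=> [c ->] [d ->]; exists (a * c + d); rewrite scalerA scalerDl. Qed.
Fact zero_set_closed : closed zero_set.
Proof.
apply/closed_approx => f fP; exists (f z); apply: l1_inj => t; rewrite l1ZE /=.
have [->|tz] := eqVneq t z; first by rewrite mulr1.
rewrite mulr0; apply/rnorm_le0/ler_addgt0Pr => e /fP[_ [c ->] h].
rewrite add0r; apply: le_trans h; apply: le_trans (l1_val_le _ t).
by rewrite l1BE l1ZE /= (negbTE tz) mulr0 subr0.
Qed.
Definition zero_csub : csubspace (l1alg R T) :=
  CSubspace zero_set0 zero_setP zero_set_closed.

Fact zero_setl a x : zero_csub x -> zero_csub (amul a x).
Proof.
move=> [c ->]; rewrite /= (linZ (@conv_linr R T a)); apply: (@csubZ _ _ zero_csub).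
apply/qpi_eq0; have [l0 _] := qpi_bl zero_csub.
apply: (l1_ext (f := fun a => qpi zero_csub (conv a (delta R z))) (g := fun=> 0)).
- by apply: (bl_comp (qpi_bl zero_csub)); exact: conv_blinl.
- by split=> [b u v|]; [rewrite scaler0 addr0|exists 0 => u; rewrite rnorm0 mul0r].
move=> s; rewrite conv_delta zr; apply/qpi_eq0.
by exists 1; rewrite scale1r.
Qed.

Fact zero_setr a x : zero_csub x -> zero_csub (amul x a).
Proof.
move=> [c ->]; rewrite /= (linZ (@conv_linl R T a)); apply: (@csubZ _ _ zero_csub).
apply/qpi_eq0.
apply: (l1_ext (f := fun a => qpi zero_csub (conv (delta R z) a)) (g := fun=> 0)).
- by apply: (bl_comp (qpi_bl zero_csub)); exact: conv_blinr.
- by split=> [b u v|]; [rewrite scaler0 addr0|exists 0 => u; rewrite rnorm0 mul0r].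
move=> s; rewrite conv_delta zl; apply/qpi_eq0.
by exists 1; rewrite scale1r.
Qed.

Definition zero_ideal : closed_ideal (l1alg R T) :=
  ClosedIdeal zero_setl zero_setr.

Definition redalg : banachAlg R := quotalg zero_ideal.

Definition redelt (t : T) : redalg := qpi zero_ideal (delta R t).

Lemma redelt_mul s t : amul (redelt s) (redelt t) = redelt (s * t)%g.
Proof. by rewrite /= qmulE /= conv_delta. Qed.

End ReducedAlgebra.

Section Corners.
Context {R : realType}.
Local Notation C := R[i].

Section IdempotentRange.
Context {V : normedModType C} (f : V -> V).
Hypotheses (fb : bounded_linear f) (ff : forall x, f (f x) = f x).

Definition range_set : set V := [set x | exists a, x = f a].
Let lf : linear f := proj1 fb.

Fact range_setP0 x : range_set x <-> f x = x.
Proof. by split=> [[a ->]|<-]; [exact: ff|exists x]. Qed.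
Fact range_set0 : range_set 0. Proof. by exists 0; rewrite (lin0 lf). Qed.
Fact range_setP (a : C) x y : range_set x -> range_set y -> range_set (a *: x + y).
Proof. by move=> [u ->] [v ->]; exists (a *: u + v); rewrite lf. Qed.
Fact range_set_closed : closed range_set.
Proof.
have [U UP] := bl_ker_csub (bl_lincomb (-1) (bl_id V) fb).
rewrite (_ : range_set = U); first exact: csub_closed.
apply/seteqP; split=> x.
  by move=> /range_setP0 fx; apply/UP; rewrite fx scaleN1r addNr.
move=> /UP/eqP; rewrite scaleN1r addrC subr_eq0 => /eqP fx.
by apply/range_setP0.
Qed.
Definition range_csub : csubspace V :=
  CSubspace range_set0 range_setP range_set_closed.
End IdempotentRange.

Context {A : banachAlg R} (e : A) (ee : amul e e = e).

Let Lb : bounded_linear (amul e) := bb_right e (amul_bb A).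
Let Rb : bounded_linear (fun x => amul x e) := bb_left e (amul_bb A).
Fact corner_bl : bounded_linear (fun x => amul (amul e x) e).
Proof. exact: (bl_comp Rb Lb). Qed.
Fact Lidem x : amul e (amul e x) = amul e x. Proof. by rewrite amulA ee. Qed.
Fact Ridem x : amul (amul x e) e = amul x e. Proof. by rewrite -amulA ee. Qed.
Fact corner_idem x :
  amul (amul e (amul (amul e x) e)) e = amul (amul e x) e.
Proof. by rewrite -(amulA e x e) Lidem !amulA Ridem. Qed.

Definition eA_csub : csubspace A := range_csub Lb Lidem.
Definition Ae_csub : csubspace A := range_csub Rb Ridem.
Definition eAe_csub : csubspace A := range_csub corner_bl corner_idem.

Lemma eA_P x : eA_csub x <-> amul e x = x.
Proof. exact: (range_setP0 Lidem). Qed.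
Lemma Ae_P x : Ae_csub x <-> amul x e = x.
Proof. exact: (range_setP0 Ridem). Qed.
Lemma eAe_P x : eAe_csub x <-> amul e x = x /\ amul x e = x.
Proof.
split=> [/(range_setP0 corner_idem) h|[h1 h2]].
  by split; rewrite -h ?Ridem// amulA Lidem.
by apply/(range_setP0 corner_idem); rewrite h1 h2.
Qed.

Fact eA_mulr (x : subban eA_csub) a : eA_csub (amul (sbval x) a).
Proof. by apply/eA_P; rewrite amulA; have /eA_P -> := sbvalP x. Qed.
Fact Ae_mull a (x : subban Ae_csub) : Ae_csub (amul a (sbval x)).
Proof. by apply/Ae_P; rewrite -amulA; have /Ae_P -> := sbvalP x. Qed.
Fact eAe_mul (x y : subban eAe_csub) : eAe_csub (amul (sbval x) (sbval y)).
Proof.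
apply/eAe_P; rewrite amulA -(amulA _ _ e).
by have /eAe_P[-> _] := sbvalP x; have /eAe_P[_ ->] := sbvalP y.
Qed.
Fact eAe_eA_mul (x : subban eAe_csub) (y : subban eA_csub) :
  eA_csub (amul (sbval x) (sbval y)).
Proof. by apply/eA_P; rewrite amulA; have /eAe_P[-> _] := sbvalP x. Qed.
Fact Ae_eAe_mul (x : subban Ae_csub) (y : subban eAe_csub) :
  Ae_csub (amul (sbval x) (sbval y)).
Proof. by apply/Ae_P; rewrite -amulA; have /eAe_P[_ ->] := sbvalP y. Qed.
Fact eA_Ae_mul (x : subban eA_csub) (y : subban Ae_csub) :
  eAe_csub (amul (sbval x) (sbval y)).
Proof.
apply/eAe_P; rewrite amulA -(amulA _ _ e).
by have /eA_P -> := sbvalP x; have /Ae_P -> := sbvalP y.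
Qed.

Definition corner_amul (x y : subban eAe_csub) := SubBan (eAe_mul x y).
Fact corner_linl y : linear (corner_amul^~ y).
Proof. by move=> c x x'; apply: sbval_inj; exact: amul_linl. Qed.
Fact corner_linr x : linear (corner_amul x).
Proof. by move=> c y y'; apply: sbval_inj; exact: amul_linr. Qed.
Fact corner_mulA x y z :
  corner_amul x (corner_amul y z) = corner_amul (corner_amul x y) z.
Proof. by apply: sbval_inj; exact: amulA. Qed.
Fact corner_norm x y : `|corner_amul x y| <= `|x| * `|y|.
Proof. exact: amul_norm. Qed.

Definition corner : banachAlg R :=
  BanachAlg corner_linl corner_linr corner_mulA corner_norm.

Definition eA_lact (b : corner) (x : subban eA_csub) := SubBan (eAe_eA_mul b x).
Definition eA_ract (x : subban eA_csub) (a : A) := SubBan (eA_mulr x a).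

Fact eA_lact_bb : bounded_bilinear eA_lact.
Proof.
split=> [y c x x'|x c y y'|].
- by apply: sbval_inj; exact: amul_linl.
- by apply: sbval_inj; exact: amul_linr.
- by exists 1 => x y; rewrite mul1r; exact: amul_rnorm.
Qed.
Fact eA_ract_bb : bounded_bilinear eA_ract.
Proof.
split=> [y c x x'|x c y y'|].
- by apply: sbval_inj; exact: amul_linl.
- by apply: sbval_inj; exact: amul_linr.
- by exists 1 => x y; rewrite mul1r; exact: amul_rnorm.
Qed.
Fact eA_lactA b b' x : eA_lact (amul b b') x = eA_lact b (eA_lact b' x).
Proof. by apply: sbval_inj; rewrite /= amulA. Qed.
Fact eA_ractA x a a' : eA_ract x (amul a a') = eA_ract (eA_ract x a) a'.
Proof. by apply: sbval_inj; rewrite /= amulA. Qed.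
Fact eA_lractA b x a : eA_ract (eA_lact b x) a = eA_lact b (eA_ract x a).
Proof. by apply: sbval_inj; rewrite /= amulA. Qed.

Definition eA : bimod corner A :=
  @Bimod R corner A (subban eA_csub) eA_lact eA_ract eA_lact_bb eA_ract_bb
    eA_lactA eA_ractA eA_lractA.

Definition Ae_lact (a : A) (x : subban Ae_csub) := SubBan (Ae_mull a x).
Definition Ae_ract (x : subban Ae_csub) (b : corner) := SubBan (Ae_eAe_mul x b).

Fact Ae_lact_bb : bounded_bilinear Ae_lact.
Proof.
split=> [y c x x'|x c y y'|].
- by apply: sbval_inj; exact: amul_linl.
- by apply: sbval_inj; exact: amul_linr.
- by exists 1 => x y; rewrite mul1r; exact: amul_rnorm.
Qed.
Fact Ae_ract_bb : bounded_bilinear Ae_ract.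
Proof.
split=> [y c x x'|x c y y'|].
- by apply: sbval_inj; exact: amul_linl.
- by apply: sbval_inj; exact: amul_linr.
- by exists 1 => x y; rewrite mul1r; exact: amul_rnorm.
Qed.
Fact Ae_lactA a a' x : Ae_lact (amul a a') x = Ae_lact a (Ae_lact a' x).
Proof. by apply: sbval_inj; rewrite /= amulA. Qed.
Fact Ae_ractA x b b' : Ae_ract x (amul b b') = Ae_ract (Ae_ract x b) b'.
Proof. by apply: sbval_inj; rewrite /= amulA. Qed.
Fact Ae_lractA a x b : Ae_ract (Ae_lact a x) b = Ae_lact a (Ae_ract x b).
Proof. by apply: sbval_inj; rewrite /= amulA. Qed.

Definition Ae : bimod A corner :=
  @Bimod R A corner (subban Ae_csub) Ae_lact Ae_ract Ae_lact_bb Ae_ract_bb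
    Ae_lactA Ae_ractA Ae_lractA.

Definition mul_eA_Ae (p : eA) (q : Ae) : reg corner := SubBan (eA_Ae_mul p q).
Definition mul_Ae_eA (q : Ae) (p : eA) : reg A := amul (sbval q) (sbval p).

End Corners.

Definition banachAlg_iso (R : realType) (A B : banachAlg R) (f : A -> B) : Prop :=
  banach_iso f /\ forall x y, f (amul x y) = amul (f x) (f y).

(* None is the adjoined zero, both among the entries of the sandwich matrix p
   and in the semigroup; the product depends on p, the carrier does not. *)
Definition rees (I L : choiceType) (G : groupType) (p : L -> I -> option G) : Type :=
  option (I * G * L)%type.

Section Rees.
Context {I L : choiceType} {G : groupType} (p : L -> I -> option G).
Local Notation rees := (rees p).
HB.instance Definition _ := Choice.on rees.

Definition rees_mul (x y : rees) : rees :=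
  match x, y with
  | Some (i, g, l), Some (j, h, m) =>
      if p l j is Some q then Some (i, (g * q * h)%g, m) else None
  | _, _ => None
  end.

Fact rees_mulA : associative rees_mul.
Proof.
move=> [[[i g] l]|] [[[j h] m]|] [[[k f] n]|] //=; last by case: (p l j).
case mk: (p m k) => [q|]; case lj: (p l j) => [r|] //=; rewrite ?mk ?lj //.
by rewrite !mulgA.
Qed.
HB.instance Definition _ := isSemigroup.Build rees rees_mulA.

Definition rees0 : rees := None.
Lemma rees0l (x : rees) : (rees0 * x)%g = rees0. Proof. by []. Qed.
Lemma rees0r (x : rees) : (x * rees0)%g = rees0. Proof. by case: x => [[[]]|]. Qed.

Definition sandwich_regular : Prop :=
  (forall l, exists i, p l i <> None) /\ (forall i, exists l, p l i <> None).

Definition reesalg (R : realType) : banachAlg R := redalg R rees0l rees0r.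

Definition reeselt (R : realType) (i : I) (g : G) (l : L) : reesalg R :=
  redelt R rees0l rees0r (Some (i, g, l)).

Lemma reeselt_idem (R : realType) i l g : p l i = Some g ->
  amul (reeselt R i g^-1%g l) (reeselt R i g^-1%g l) = reeselt R i g^-1%g l.
Proof.
move=> pli; rewrite redelt_mul; congr (redelt _ _ _ _).
suff : rees_mul (Some (i, g^-1, l)%g) (Some (i, g^-1, l)%g) = Some (i, g^-1, l)%g by [].
by rewrite /= pli mulVg mul1g.
Qed.
End Rees.

(* Main.v *)
(* Let e = (i, q^-1, l), P = eA and Q = Ae. For any idempotent e the map
   b |-> b (x) e inverts multiplication from P (x)_A Q to B, and tensoring with
   e likewise shows that B, P and Q are induced. For the Rees semigroup the
   inverse of multiplication from Q (x)_B P to A sends the basis element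
   (j, h, m) to (j, h, l) (x) (i, q^-1, m). This inverse also gives that A is
   self-induced: composing it with x (x) y |-> x (x) e (x) y inverts the triple
   multiplication, because every a in A is a limit of sums of products xy with
   x in Q and y in P, and xy (x) b (x) c = x (x) e (x) ybc. *)
Require Import Defs.
From HB Require Import structures.
From mathcomp Require Import all_boot all_order all_algebra.
From mathcomp Require Import all_classical all_reals all_analysis.
From mathcomp Require Import complex.
Import Order.TTheory GRing.Theory Num.Theory.
Import numFieldNormedType.Exports.
Local Open Scope ring_scope.

(** * Isomorphisms out of a balanced tensor product *)

Section BalancedTensorIso.
Context {R : realType}.
Local Notation C := R[i].
Context {A B D : banachAlg R}.

Lemma btens_lift (X : bimod A B) (Y : bimod B D) (W : completeNormedModType C)
    (f : X -> Y -> W) :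
  bounded_bilinear f -> (forall x b y, f (ract x b) y = f x (lact b y)) ->
  exists2 g : btens X Y -> W, bounded_linear g &
    forall x y, g (btens_elt x y) = f x y.
Proof.
move=> fb fbal; have [M M0 MP] := bb_bound fb.
have [g [lg gM gE]] := btens_univ M0 fb MP fbal.
by exists g => //; split=> //; exists M.
Qed.

Lemma banach_iso_section (V W : normedModType C) (f : V -> W) (s : W -> V) :
  bounded_linear f -> bounded_linear s -> cancel f s -> cancel s f ->
  banach_iso f.
Proof. by move=> fb sb fs sf; split=> //; exists s. Qed.

(** The linear map that [f] induces is known only through its values on elementary tensors. Hence
    [cancel s phi] is asked for every bounded [phi] with these values, while the other composite and
    the bimodule laws are tested on elementary tensors. *)
Lemma implements_isoI (X : bimod A B) (Y : bimod B D) (Z : bimod A D)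
    (f : X -> Y -> Z) (s : Z -> btens X Y) :
  balanced_module_map f -> bounded_linear s ->
  (forall x y, s (f x y) = btens_elt x y) ->
  (forall phi : btens X Y -> Z, bounded_linear phi ->
    (forall x y, phi (btens_elt x y) = f x y) -> cancel s phi) ->
  implements_iso f.
Proof.
move=> [fb fbal fl fr] sb sf h; have [phi phib phiE] := btens_lift _ _ _ _ fb fbal.
exists phi; split=> //; split.
- apply: (banach_iso_section _ _ _ s) => //; last exact: h.
  apply: btens_ext; [exact: bl_comp|exact: bl_id|].
  by move=> x y; rewrite phiE sf.
- move=> a; apply: btens_ext.
  + exact: (bl_comp phib (btens_lact_bl _ _ a)).
  + exact: (bl_comp (bb_right a (lact_bb Z)) phib).
  + by move=> x y; rewrite /= btens_lactE !phiE fl.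
- move=> t d; move: t; apply: btens_ext.
  + exact: (bl_comp phib (btens_ract_bl _ _ d)).
  + exact: (bl_comp (bb_left d (ract_bb Z)) phib).
  + by move=> x y; rewrite /= btens_ractE !phiE fr.
Qed.

End BalancedTensorIso.

(** * Triple tensor products and a criterion for induced bimodules *)

Section Induced.
Context {R : realType}.
Local Notation C := R[i].
Context {A B : banachAlg R} (X : bimod A B).

Definition tens3 (a : A) (x : X) (b : B) : btens (btens (reg A) X) (reg B) :=
  btens_elt (X := btens (reg A) X) (Y := reg B)
    (btens_elt (X := reg A) (Y := X) a x) b.

Lemma tens3_bb x : bounded_bilinear (fun a b => tens3 a x b).
Proof.
apply: (bb_compl _ (btens_elt_bb (btens (reg A) X) (reg B))).
exact: (bb_left x (btens_elt_bb (reg A) X)).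
Qed.

Lemma tens3_bal1 a a' x b : tens3 (amul a a') x b = tens3 a (lact a' x) b.
Proof.
by rewrite /tens3 -(btens_elt_bal (X := reg A)).
Qed.

Lemma tens3_bal2 a x b' b : tens3 a (ract x b') b = tens3 a x (amul b' b).
Proof.
by rewrite /tens3 -btens_ractE (btens_elt_bal (X := btens (reg A) X) (Y := reg B)).
Qed.

Lemma tens3_ext (W : normedModType C)
    (f g : btens (btens (reg A) X) (reg B) -> W) :
  bounded_linear f -> bounded_linear g ->
  (forall a x b, f (tens3 a x b) = g (tens3 a x b)) -> forall t, f t = g t.
Proof.
move=> fb gb fg; apply: btens_ext => // t b; move: t.
have tb := bb_left b (btens_elt_bb (btens (reg A) X) (reg B)).
by apply: btens_ext => [||a x]; [exact: bl_comp|exact: bl_comp|exact: fg].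
Qed.

(** Analogue of [implements_isoI] for the triple product: the multiplication map is built one
    bracket at a time, and [s] is its inverse. *)
Lemma inducedI (s : X -> btens (btens (reg A) X) (reg B)) :
  bounded_linear s ->
  (forall a x b, s (ract (lact a x) b) = tens3 a x b) ->
  (forall phi : btens (btens (reg A) X) (reg B) -> X, bounded_linear phi ->
    (forall a x b, phi (tens3 a x b) = ract (lact a x) b) -> cancel s phi) ->
  Defs.induced X.
Proof.
move=> sb sE h.
have [mu mub muE] := btens_lift (reg A) X _ _ (lact_bb X)
  (fun a a' x => lactA a a' x).
(* Right linearity of [mu] over [B] is what makes the pairing of [t] and [b] to [ract (mu t) b]
   balanced. *)
have mur t b : mu (ract t b) = ract (mu t) b.
  move: t; apply: btens_ext.
  - exact: (bl_comp mub (btens_ract_bl _ _ b)).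
  - exact: (bl_comp (bb_left b (ract_bb X)) mub).
  - by move=> a x; rewrite /= btens_ractE !muE lractA.
have [|phi phib phiE] := btens_lift (btens (reg A) X) (reg B) _
    (fun t b => ract (mu t) b) (bb_compl mub (ract_bb X)).
  by move=> t b b'; rewrite mur ractA.
have phi3 a x b : phi (tens3 a x b) = ract (lact a x) b by rewrite phiE muE.
exists phi; split; last exact: phi3.
split.
- apply: (banach_iso_section _ _ _ s) => //; last exact: h.
  apply: tens3_ext; [exact: bl_comp|exact: bl_id|].
  by move=> a x b; rewrite phi3 sE.
- move=> a; apply: tens3_ext.
  + exact: (bl_comp phib (btens_lact_bl _ _ a)).
  + exact: (bl_comp (bb_right a (lact_bb X)) phib).
  (* The left action passes through both brackets to the factor in [A]. *)
  + move=> a' x b; rewrite [lact a _]btens_lactE [lact a _]btens_lactE.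
    by rewrite -[btens_elt _ _]/(tens3 _ _ _) !phi3 lractA lactA -!lractA.
- move=> t d; move: t; apply: tens3_ext.
  + exact: (bl_comp phib (btens_ract_bl _ _ d)).
  + exact: (bl_comp (bb_left d (ract_bb X)) phib).
  + move=> a x b; rewrite [ract _ d]btens_ractE.
    by rewrite -[btens_elt _ _]/(tens3 _ _ _) !phi3 ractA.
Qed.

End Induced.

(** * Corners of a Banach algebra at an idempotent *)

Section Corner.
Context {R : realType}.
Local Notation C := R[i].
Context {A : banachAlg R} {e : A} (ee : amul e e = e).

(** In the corner [e] is a two-sided unit. In [eA] and [Ae] it generates: a |-> ea and a |-> ae
    project [A] onto these modules. *)
Definition cornerP : eA ee := SubBan (proj2 (eA_P ee e) ee).
Definition cornerQ : Ae ee := SubBan (proj2 (Ae_P ee e) ee).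
Definition corner1 : corner ee := SubBan (proj2 (eAe_P ee e) (conj ee ee)).

Lemma eA_mull (x : eA ee) : amul e (sbval x) = sbval x.
Proof. by apply/eA_P; exact: sbvalP. Qed.

Lemma Ae_mulr (x : Ae ee) : amul (sbval x) e = sbval x.
Proof. by apply/Ae_P; exact: sbvalP. Qed.

Lemma corner_mull (x : corner ee) : amul e (sbval x) = sbval x.
Proof. by have /eAe_P[] := sbvalP x. Qed.

Lemma corner_mulr (x : corner ee) : amul (sbval x) e = sbval x.
Proof. by have /eAe_P[] := sbvalP x. Qed.

Lemma mul_eA_Ae_bmm : balanced_module_map (mul_eA_Ae (ee := ee)).
Proof.
split=> [|x a y|b x y|x y b]; try by apply: sbval_inj; rewrite /= amulA.
split=> [y c x x'|x c y y'|].
- by apply: sbval_inj; exact: amul_linl.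
- by apply: sbval_inj; exact: amul_linr.
- by exists 1 => x y; rewrite mul1r; exact: amul_rnorm.
Qed.

Lemma mul_Ae_eA_bmm : balanced_module_map (mul_Ae_eA (ee := ee)).
Proof.
split=> [|x a y|b x y|x y b]; try by rewrite /mul_Ae_eA /= amulA.
split=> [y c x x'|x c y y'|]; [exact: amul_linl|exact: amul_linr|].
by exists 1 => x y; rewrite mul1r; exact: amul_rnorm.
Qed.

Lemma sbval_bl (V : completeNormedModType C) (U : csubspace V) :
  bounded_linear (fun x : subban U => sbval x).
Proof. by split=> [//|]; exists 1 => x; rewrite mul1r. Qed.

Lemma subban_bl (W : normedModType C) (V : completeNormedModType C)
    (U : csubspace V) (f : W -> subban U) :
  bounded_linear (fun x => sbval (f x)) -> bounded_linear f.
Proof. by move=> [lf fM]; split=> // a x y; apply: sbval_inj; exact: lf. Qed.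

Lemma corner_eA (b : corner ee) : eA_csub ee (sbval b).
Proof. by apply/eA_P; exact: corner_mull. Qed.

(** Since y = ye, the factor y moves across as an element of [A]: x (x) y = x (x) ye = xy (x) e. *)
Lemma corner_implements_iso : implements_iso (mul_eA_Ae (ee := ee)).
Proof.
apply: (implements_isoI _ _ (reg (corner ee)) _ (fun b : reg (corner ee) =>
  btens_elt (X := eA ee) (Y := Ae ee) (SubBan (corner_eA b)) cornerQ)).
- exact: mul_eA_Ae_bmm.
- apply: (bl_comp (bb_left cornerQ (btens_elt_bb (eA ee) (Ae ee)))).
  by apply: subban_bl; exact: sbval_bl.
- move=> x y; rewrite (_ : SubBan _ = ract x (sbval y)); last first.
    by apply: sbval_inj.
  rewrite btens_elt_bal; congr btens_elt; apply: sbval_inj; exact: Ae_mulr.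
- move=> phi _ phiE b; rewrite phiE; apply: sbval_inj; exact: corner_mulr.
Qed.

(** The corner is unital, so a (x) x (x) b collapses to axb (x) 1 (x) 1. *)
Lemma corner_self_induced : self_induced (corner ee).
Proof.
apply: (inducedI (reg (corner ee))
  (fun b => tens3 (reg (corner ee)) b corner1 corner1)).
- exact: (bb_left corner1 (tens3_bb (reg (corner ee)) corner1)).
- move=> a x b; rewrite (lractA (b0 := reg (corner ee))) tens3_bal1.
  have -> : lact (b0 := reg (corner ee)) (ract x b) corner1 = ract x b.
    by apply: sbval_inj; exact: corner_mulr.
  rewrite tens3_bal2; congr tens3; apply: sbval_inj; exact: corner_mulr.
- move=> phi _ phiE b; rewrite phiE; apply: sbval_inj.
  by rewrite /= !corner_mulr.
Qed.

(** [A] may lack a unit, so its factor carries the whole product: 1 (x) e (x) bya = 1 (x) by (x) a =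
    b (x) y (x) a, because by lies in eA. *)
Lemma eA_induced : Defs.induced (eA ee).
Proof.
apply: (inducedI (eA ee) (fun y : eA ee => tens3 (eA ee) corner1 cornerP (sbval y))).
- apply: (bl_comp (bb_right corner1 (tens3_bb (eA ee) cornerP))); exact: sbval_bl.
- move=> b y a; rewrite -[sbval _]/(amul (sbval (lact b y)) a) -tens3_bal2.
  have -> : ract cornerP (sbval (lact b y)) = lact b y.
    by apply: sbval_inj; exact: eA_mull.
  rewrite -tens3_bal1; congr tens3; apply: sbval_inj; exact: corner_mull.
- move=> phi _ phiE y; rewrite phiE; apply: sbval_inj.
  by rewrite /= ee eA_mull.
Qed.

(** Mirror image of [eA_induced]: axb (x) e (x) 1 = a (x) xb (x) 1 = a (x) x (x) b. *)
Lemma Ae_induced : Defs.induced (Ae ee).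
Proof.
apply: (inducedI (Ae ee) (fun x : Ae ee => tens3 (Ae ee) (sbval x) cornerQ corner1)).
- apply: (bl_comp (bb_left corner1 (tens3_bb (Ae ee) cornerQ))); exact: sbval_bl.
- move=> a x b; rewrite lractA -[sbval _]/(amul a (sbval (ract x b))) tens3_bal1.
  have -> : lact (sbval (ract x b)) cornerQ = ract x b.
    by apply: sbval_inj; exact: Ae_mulr.
  rewrite tens3_bal2; congr tens3; apply: sbval_inj; exact: corner_mulr.
- move=> phi _ phiE x; rewrite phiE; apply: sbval_inj.
  by rewrite /= !Ae_mulr.
Qed.

(** Everything that fails for a general idempotent, such as e = 0, is concentrated in the inverse
    [s]; its existence forces the products xy with x in Ae and y in eA to span a dense subspace of
    [A]. *)
Lemma corner_morita (s : A -> btens (Ae ee) (eA ee)) :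
  bounded_linear s ->
  (forall x y, s (mul_Ae_eA x y) = btens_elt x y) ->
  (forall phi : btens (Ae ee) (eA ee) -> A, bounded_linear phi ->
    (forall x y, phi (btens_elt x y) = mul_Ae_eA x y) -> cancel s phi) ->
  morita_equivalence (P := eA ee) (Q := Ae ee)
    (mul_eA_Ae (ee := ee)) (mul_Ae_eA (ee := ee)).
Proof.
move=> sb sE sK.
have [fb fbal fl fr] := mul_Ae_eA_bmm.
have [mu mub muE] := btens_lift (Ae ee) (eA ee) (reg A) _ fb fbal.
(* By [sK] every element of [A] is the image under [mu] of a tensor, so bounded maps on [A] may be
   compared on products xy. *)
have Aext (W : normedModType C) (f g : A -> W) :
    bounded_linear f -> bounded_linear g ->
    (forall (x : Ae ee) (y : eA ee),
      f (amul (sbval x) (sbval y)) = g (amul (sbval x) (sbval y))) ->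
    forall a, f a = g a.
  move=> fb' gb fg a; rewrite -(sK mu mub muE a); move: (s a).
  apply: btens_ext; [exact: bl_comp|exact: bl_comp|].
  by move=> x y; rewrite muE; exact: fg.
(* Both actions on the regular bimodule are [amul]; the balancing rules are restated so that they
   rewrite products. *)
have t1 a b x c : tens3 (reg A) (amul a b) x c = tens3 (reg A) a (amul b x) c.
  exact: (tens3_bal1 (reg A)).
have t2 a x b c : tens3 (reg A) a (amul x b) c = tens3 (reg A) a x (amul b c).
  exact: (tens3_bal2 (reg A)).
split=> //.
- have jb : bounded_bilinear (fun (x : Ae ee) (y : eA ee) =>
      tens3 (reg A) (sbval x) e (sbval y)).
    have bb := bb_compr (sbval_bl _ (eA_csub ee)) (tens3_bb (reg A) e).
    exact: (bb_compl (sbval_bl _ (Ae_csub ee)) bb).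
  have [|j jbl jE] := btens_lift (Ae ee) (eA ee) _ _ jb.
    move=> x b y /=.
    (* xb (x) e (x) y = x (x) be (x) y = x (x) eb (x) y = x (x) e (x) by, since be = b = eb. *)
    by rewrite t1 corner_mulr -[in LHS](corner_mull b) t2.
  have jsE (x : Ae ee) (y : eA ee) :
      j (s (amul (sbval x) (sbval y))) = tens3 (reg A) (sbval x) e (sbval y).
    by rewrite -jE -sE.
  have jsb := bl_comp jbl sb.
  apply: (inducedI (reg A) (fun a => j (s a))) => //.
  + move=> a x b; move: a; apply: Aext.
    * apply: (bl_comp (f := fun a => j (s a)) jsb).
      by apply: (bl_comp (bb_left b (amul_bb A))); exact: bb_left (amul_bb A).
    * exact: (bb_left b (tens3_bb (reg A) x)).
    * move=> u v.
      (* With v = ev: uv (x) x (x) b = u (x) e(vx) (x) b = u (x) e (x) vxb, and vxb again lies in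
         eA. *)
      rewrite t1 -[in RHS](eA_mull v) -[amul (amul e _) x]amulA t2.
      by rewrite -(jsE u (ract (ract v x) b)) /= !amulA.
  + move=> phi phib phiE; apply: Aext.
    * exact: bl_comp phib jsb.
    * exact: bl_id.
    * by move=> x y; rewrite jsE phiE /= Ae_mulr.
- exact: corner_self_induced.
- exact: eA_induced.
- exact: Ae_induced.
- exact: mul_eA_Ae_bmm.
- exact: corner_implements_iso.
- exact: (implements_isoI _ _ (reg A) _ s).
- by move=> p q p'; apply: sbval_inj; rewrite /= amulA.
- by move=> p q p'; apply: sbval_inj; rewrite /= amulA.
Qed.

End Corner.

(** * Basis elements of the reduced algebra of a Rees semigroup *)

Section ReesBasis.
Context {R : realType} {I L : choiceType} {G : groupType} (p : L -> I -> option G).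
Local Notation C := R[i].

(** The semigroup zero is sent to 0, so the extension to ell^1 vanishes on the ideal it spans and
    descends to the quotient. *)
Lemma reesalg_lift (W : completeNormedModType C) (phi : I -> G -> L -> W) (M : R) :
  (forall j h m, rnorm (phi j h m) <= M) ->
  exists2 F : reesalg p R -> W, bounded_linear F &
    forall j h m, F (reeselt p R j h m) = phi j h m.
Proof.
move=> phiM.
pose psi (t : rees p) : W := if t is Some (j, h, m) then phi j h m else 0.
(* If there are no triples, [M] may be negative, yet the value 0 at the semigroup zero still needs a
   bound; hence the absolute value. *)
have psiM t : rnorm (psi t) <= `|M|.
  case: t => [[[j h] m]|] /=; last by rewrite rnorm0.
  exact: le_trans (phiM _ _ _) (ler_norm _).
have psib := l1_lift_bl psiM.
have [|F Fb FE] := quotban_bl (U := zero_ideal R (@rees0l I L G p) (@rees0r I L G p)) psib.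
  by move=> x [c ->]; rewrite (linZ (proj1 psib)) (l1_lift_delta psiM) scaler0.
by exists F => // j h m; rewrite FE (l1_lift_delta psiM).
Qed.

Lemma reesalg_ext (W : normedModType C) (f g : reesalg p R -> W) :
  bounded_linear f -> bounded_linear g ->
  (forall j h m, f (reeselt p R j h m) = g (reeselt p R j h m)) ->
  forall a, f a = g a.
Proof.
move=> fb gb fg a; have [u <-] := qpi_surj a.
apply: (l1_ext (bl_comp fb (qpi_bl _)) (bl_comp gb (qpi_bl _))) => -[[[j h] m]|].
  exact: fg.
rewrite (_ : qpi _ _ = 0) ?(lin0 (proj1 fb)) ?(lin0 (proj1 gb))//.
by apply/qpi_eq0; exists 1; rewrite scale1r.
Qed.

Lemma reeselt_mul j h m k g n q : p m k = Some q ->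
  amul (reeselt p R j h m) (reeselt p R k g n) = reeselt p R j (h * q * g)%g n.
Proof.
move=> pmk; rewrite redelt_mul; congr (redelt _ _ _ _).
suff : rees_mul (Some (j, h, m)) (Some (k, g, n) : rees p) = Some (j, h * q * g, n)%g by [].
by rewrite /= pmk.
Qed.

Lemma reeselt_mul0 j h m k g n : p m k = None ->
  amul (reeselt p R j h m) (reeselt p R k g n) = 0.
Proof.
move=> pmk; rewrite redelt_mul (_ : (_ * _)%g = @rees0 I L G p).
  by apply/qpi_eq0; exists 1; rewrite scale1r.
suff : rees_mul (Some (j, h, m)) (Some (k, g, n) : rees p) = None by [].
by rewrite /= pmk.
Qed.

Lemma rnorm_reeselt j h m : rnorm (reeselt p R j h m) <= 1.
Proof. by rewrite (le_trans (rnorm_qpi _ _))// rnorm_delta. Qed.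

End ReesBasis.

(** * The corner of a Rees semigroup algebra and its Morita equivalence *)

Section ReesCorner.
Context {R : realType} {I L : choiceType} {G : groupType} {p : L -> I -> option G}.
Context {i : I} {l : L} {q : G} (pli : p l i = Some q).
Local Notation C := R[i].
Local Notation A := (reesalg p R).
Local Notation e := (reeselt p R i (q^-1)%g l).
Local Notation ee := (reeselt_idem R pli).
Local Notation E := (reeselt p R).

Fact reeselt_Ae j h : Ae_csub ee (E j h l).
Proof. by apply/Ae_P; rewrite (reeselt_mul p _ _ _ _ _ _ _ pli) mulgK. Qed.

Fact reeselt_eA k m : eA_csub ee (E i k m).
Proof. by apply/eA_P; rewrite (reeselt_mul p _ _ _ _ _ _ _ pli) mulVg mul1g. Qed.

Fact reeselt_eAe g : eAe_csub ee (E i g l).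
Proof.
have /eA_P el := reeselt_eA g l; have /Ae_P er := reeselt_Ae i g.
exact/eAe_P.
Qed.

Definition Ae_elt j h : Ae ee := SubBan (reeselt_Ae j h).
Definition eA_elt k m : eA ee := SubBan (reeselt_eA k m).
Definition eAe_elt g : corner ee := SubBan (reeselt_eAe g).

(** The projection a |-> ae sends a basis element (j, h, m) to some [Ae_elt], or to 0 when the entry
    [p m i] is zero, so agreement on basis elements passes from [A] to Ae. *)
Lemma Ae_ext (W : normedModType C) (f g : Ae ee -> W) :
  bounded_linear f -> bounded_linear g ->
  (forall j h, f (Ae_elt j h) = g (Ae_elt j h)) -> forall x, f x = g x.
Proof.
move=> fb gb fg x.
pose pr (a : A) : Ae ee := lact a (cornerQ ee).
have prb : bounded_linear pr by exact: (bb_left _ (lact_bb (Ae ee))).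
have -> : x = pr (sbval x) by apply: sbval_inj; exact: (esym (Ae_mulr ee x)).
move: (sbval x); apply: reesalg_ext; [exact: bl_comp|exact: bl_comp|].
move=> j h m; case mi : (p m i) => [r|].
  rewrite (_ : pr _ = Ae_elt j (h * r * q^-1)%g) ?fg//.
  by apply: sbval_inj; exact: reeselt_mul.
rewrite (_ : pr _ = 0) ?(lin0 (proj1 fb)) ?(lin0 (proj1 gb))//.
by apply: sbval_inj; exact: reeselt_mul0.
Qed.

Lemma eA_ext (W : normedModType C) (f g : eA ee -> W) :
  bounded_linear f -> bounded_linear g ->
  (forall k m, f (eA_elt k m) = g (eA_elt k m)) -> forall x, f x = g x.
Proof.
move=> fb gb fg x.
pose pr (a : A) : eA ee := ract (cornerP ee) a.
have prb : bounded_linear pr by exact: (bb_right _ (ract_bb (eA ee))).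
have -> : x = pr (sbval x) by apply: sbval_inj; exact: (esym (eA_mull ee x)).
move: (sbval x); apply: reesalg_ext; [exact: bl_comp|exact: bl_comp|].
move=> j h m; case lj : (p l j) => [r|].
  rewrite (_ : pr _ = eA_elt (q^-1 * r * h)%g m) ?fg//.
  by apply: sbval_inj; exact: reeselt_mul.
rewrite (_ : pr _ = 0) ?(lin0 (proj1 fb)) ?(lin0 (proj1 gb))//.
by apply: sbval_inj; exact: reeselt_mul0.
Qed.

(** Left multiplication by e projects Ae onto eAe, which reduces the claim to [Ae_ext]. *)
Lemma corner_ext (W : normedModType C) (f g : corner ee -> W) :
  bounded_linear f -> bounded_linear g ->
  (forall h, f (eAe_elt h) = g (eAe_elt h)) -> forall x, f x = g x.
Proof.
move=> fb gb fg b.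
pose pr (x : Ae ee) : corner ee := mul_eA_Ae (cornerP ee) x.
have [mb _ _ _] := mul_eA_Ae_bmm ee.
have prb : bounded_linear pr := bb_right _ mb.
have bQ : Ae_csub ee (sbval b) by apply/Ae_P; exact: corner_mulr.
have -> : b = pr (SubBan bQ) by apply: sbval_inj; exact: (esym (corner_mull ee b)).
move: (SubBan bQ); apply: Ae_ext; [exact: bl_comp|exact: bl_comp|].
move=> j h; case lj : (p l j) => [r|].
  rewrite (_ : pr _ = eAe_elt (q^-1 * r * h)%g) ?fg//.
  by apply: sbval_inj; exact: reeselt_mul.
rewrite (_ : pr _ = 0) ?(lin0 (proj1 fb)) ?(lin0 (proj1 gb))//.
by apply: sbval_inj; exact: reeselt_mul0.
Qed.

Lemma rees_morita : morita_equivalence (P := eA ee) (Q := Ae ee)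
  (mul_eA_Ae (ee := ee)) (mul_Ae_eA (ee := ee)).
Proof.
(* The factor [q^-1] offsets the sandwich entry [q], so that (j, h, l)(i, q^-1, m) = (j, h, m). *)
pose phi j h m : btens (Ae ee) (eA ee) :=
  btens_elt (Ae_elt j h) (eA_elt (q^-1)%g m).
have [|s sb sE] := reesalg_lift p _ phi 1.
  move=> j h m; apply: (le_trans (rnorm_btens_elt _ _)).
  by rewrite mulr_ile1 ?rnorm_ge0//; exact: rnorm_reeselt.
have [mb _ _ _] := mul_Ae_eA_bmm ee.
have tb := btens_elt_bb (Ae ee) (eA ee).
apply: (corner_morita ee s sb).
- move=> x y; move: x; apply: Ae_ext.
  + exact: (bl_comp sb (bb_left y mb)).
  + exact: (bb_left y tb).
  move=> j h; move: y; apply: eA_ext.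
  + exact: (bl_comp sb (bb_right (Ae_elt j h) mb)).
  + exact: (bb_right (Ae_elt j h) tb).
  move=> k m; rewrite [mul_Ae_eA _ _](reeselt_mul p _ _ _ _ _ _ _ pli) sE /phi.
  (* The element (i, k, l) of the corner is split off on the left and moved across: (j, hqk, l) =
     (j, h, l)(i, k, l) and (i, k, l)(i, q^-1, m) = (i, k, m). *)
  rewrite (_ : Ae_elt j (h * q * k)%g = ract (Ae_elt j h) (eAe_elt k)); last first.
    by apply: sbval_inj; rewrite [RHS](reeselt_mul p _ _ _ _ _ _ _ pli).
  rewrite btens_elt_bal; congr btens_elt; apply: sbval_inj.
  by rewrite [LHS](reeselt_mul p _ _ _ _ _ _ _ pli) mulgK.
- move=> mu mub muE; apply: reesalg_ext; [exact: bl_comp|exact: bl_id|].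
  move=> j h m; rewrite sE muE.
  by rewrite [LHS](reeselt_mul p _ _ _ _ _ _ _ pli) mulgK.
Qed.

(** The shift by [q^-1] absorbs the sandwich entry, (i, gq^-1, l)(i, hq^-1, l) = (i, ghq^-1, l), and
    sends the unit of [G] to e. *)
Lemma rees_corner_iso : exists f : l1alg R G -> corner ee, banachAlg_iso f /\
  forall g : G, sbval (f (delta R g)) = E i (g * q^-1)%g l.
Proof.
pose phi g := eAe_elt (g * q^-1)%g.
have phiM g : rnorm (phi g) <= 1 := rnorm_reeselt p _ _ _.
pose f := l1_lift phi : l1alg R G -> corner ee.
have fb : bounded_linear f := l1_lift_bl phiM.
have fE g : f (delta R g) = phi g := l1_lift_delta phiM g.
(* [F] is defined on all of [A] and forgets the outer indices; only its restriction to the corner,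
   (i, h, l) |-> hq, inverts [f]. *)
have [|F Fb FE] := reesalg_lift p (l1alg R G) (fun j h m => delta R (h * q)%g) 1.
  by move=> j h m; rewrite rnorm_delta.
have Fb' : bounded_linear (fun b : corner ee => F (sbval b)).
  by apply: (bl_comp Fb); exact: sbval_bl.
exists f; split; last by move=> g; rewrite fE.
split.
  apply: (banach_iso_section _ _ _ (fun b : corner ee => F (sbval b))) => //.
  - apply: l1_ext; [exact: bl_comp Fb' fb|exact: bl_id|].
    by move=> g; rewrite fE FE mulgVK.
  - apply: corner_ext; [exact: bl_comp fb Fb'|exact: bl_id|].
    by move=> g; rewrite FE fE /phi mulgK.
move=> x y; move: x; apply: l1_ext.
- exact: (bl_comp fb (bb_left y (amul_bb (l1alg R G)))).
- exact: (bl_comp (bb_left (f y) (amul_bb (corner ee))) fb).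
move=> g; move: y; apply: l1_ext.
- exact: (bl_comp fb (bb_right (delta R g) (amul_bb (l1alg R G)))).
- exact: (bl_comp (bb_right (f (delta R g)) (amul_bb (corner ee))) fb).
move=> h; rewrite [amul _ _]conv_delta !fE; apply: sbval_inj.
by rewrite [RHS](reeselt_mul p _ _ _ _ _ _ _ pli) mulgVK mulgA.
Qed.

End ReesCorner.

Theorem theorem2p12 (R : realType) (I L : choiceType) (G : groupType)
    (p : L -> I -> option G) (p_regular : sandwich_regular p)
    (i : I) (l : L) (q : G) (pli : p l i = Some q) :
  let A := reesalg p R in
  let e : A := reeselt p R i (q^-1)%g l in
  let ee : amul e e = e := reeselt_idem R pli in
  let B := corner ee in
  let P : bimod B A := eA ee in
  let Q : bimod A B := Ae ee in
  (exists f : l1alg R G -> B, banachAlg_iso f /\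
     forall g : G, sbval (f (delta R g)) = reeselt p R i (g * q^-1)%g l) /\
  morita_equivalence (P := P) (Q := Q)
    (mul_eA_Ae (ee := ee)) (mul_Ae_eA (ee := ee)).
Proof. by split; [exact: rees_corner_iso|exact: rees_morita]. Qed.
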